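(* Let $f:X\to Y$ be a morphism of schemes and equip the categories $\mathbf{Sch}_{/X}$ and $\mathbf{Sch}_{/Y}$ with their respective Zariski tangent structures $\mathbb T_{\mathbf{Zar}(X)}$ and $\mathbb T_{\mathbf{Zar}(Y)}$. Then the functor and natural transformation pair $(f^*,{}_fT):(\mathbf{Sch}_{/Y},\mathbb T_{\mathbf{Zar}(Y)})\to(\mathbf{Sch}_{/X},\mathbb T_{\mathbf{Zar}(X)})$ is a strong morphism of tangent categories.
   Context: Tangent categories. A tangent structure $\mathbb T=(T,p,0,+,\ell,c)$ on a category $\mathscr D$ consists of a functor $T:\mathscr D\to\mathscr D$ and natural transformations $p:T\Rightarrow\mathrm{id}$, $0:\mathrm{id}\Rightarrow T$, $+:T_2\Rightarrow T$, $\ell:T\Rightarrow T^2$, $c:T^2\Rightarrow T^2$, such that: pullback powers $T_nA$ of $p_A:TA\to A$ exist and are preserved by all $T^m$; $(p_A,+_A,0_A)$ is a commutative monoid in $\mathscr D_{/A}$; $\ell$ and $c$ are additive bundle morphisms satisfying the standard Cockett–Cruttwell coherences; and $T(+_A)\circ\langle\ell_A\pi_1,0_{TA}\pi_2\rangle:T_2A\to T^2A$ is an equalizer of $T(p_A)$ and $0_Ap_Ap_{TA}$. A morphism of tangent categories $(\mathscr D,\mathbb T)\to(\mathscr E,\mathbb S)$, $\mathbb S=(S,q,0',\oplus,\ell',c')$, is a pair $(H,\alpha)$, $H$ a functor and $\alpha:HT\Rightarrow SH$ natural with $(q H)\alpha=Hp$, $\alpha (H0)=0'H$, $\alpha (H{+})=(\oplus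 H)\alpha_2$ ($\alpha_2:HT_2\Rightarrow S_2H$ induced by $\alpha$), $(\ell' H)\alpha=(S\alpha)(\alpha T)(H\ell)$, $(c'H)(S\alpha)(\alpha T)=(S\alpha)(\alpha T)(Hc)$. It is strong if $\alpha$ is invertible and $H$ preserves the pullbacks (powers of $p$) and equalizers of the tangent structure. Zariski tangent structure $\mathbb T_{\mathbf{Zar}(S)}$ on $\mathbf{Sch}_{/S}$ (a known tangent structure): tangent functor $Z\mapsto T_{Z/S}=\underline{\mathrm{Spec}}_Z(\mathrm{Sym}(\Omega^1_{Z/S}))$, structure maps glued from affine pieces $S=\mathrm{Spec}A$, $Z=\mathrm{Spec}B$, where $\mathrm{Sym}_B(\Omega^1_{B/A})$ is generated by symbols $b,\mathrm db$ ($b\in B$) and the ring of $T^2_{B/A}$ by symbols $b,\mathrm db,\delta b,\delta\mathrm db$: $p$ is dual to $b\mapsto b$; $0$ to $b\mapsto b,\ \mathrm db\mapsto0$; $+$ to $b\mapsto b\otimes1,\ \mathrm db\mapsto\mathrm db\otimes1+1\otimes\mathrm db$; $\ell$ to $b\mapsto b,\ \mathrm db\mapsto0,\ \delta b\mapsto0,\ \delta\mathrm db\mapsto\mathrm db$; $c$ to $b\mapsto b,\ \mathrm db\leftrightarrow\delta b,\ \delta\mathrm db\mapsto\delta\mathrm db$. $f^*:\mathbf{Sch}_{/Y}\to\mathbf{Sch}_{/X}$ is $Z\mapsto Z\times_YX$, and ${}_fT:f^*\circ T_{-/Y}\Rightarrow T_{-/X}\circ f^*$ has components the canonical isomorphisms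 $T_{Z/Y}\times_YX\cong T_{Z\times_YX/X}$ (EGA IV 16.5.12.2); for $X=\mathrm{Spec}A$, $Y=\mathrm{Spec}C$, $Z=\mathrm{Spec}B$ it is dual to the ring isomorphism $\theta_B:\mathrm{Sym}(\Omega^1_{B\otimes_CA/A})\to\mathrm{Sym}(\Omega^1_{B/C})\otimes_CA$, $b\otimes a\mapsto b\otimes a$, $\mathrm d(b\otimes a)\mapsto\mathrm db\otimes a$. *)

(* Defs.v *)
From HB Require Import structures.
From mathcomp Require Import all_boot all_algebra.
From mathcomp Require Import boolp classical_sets topology.

Set Implicit Arguments.
Unset Strict Implicit.
Unset Printing Implicit Defensive.

Import GRing.Theory.
Local Open Scope classical_set_scope.
Local Open Scope ring_scope.
#[local] Obligation Tactic := idtac.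

(** * Categories and functors *)

Record Category := MkCategory {
  ob :> Type;
  hom : ob -> ob -> Type;
  idm : forall A, hom A A;
  comp : forall A B D, hom B D -> hom A B -> hom A D;
  comp_idl : forall A B (f : hom A B), comp (idm B) f = f;
  comp_idr : forall A B (f : hom A B), comp f (idm A) = f;
  comp_assoc : forall A B D E (h : hom D E) (g : hom B D) (f : hom A B),
    comp h (comp g f) = comp (comp h g) f }.

Arguments hom {c} _ _.
Arguments idm {c} A.
Arguments comp {c A B D} _ _.
Notation "g ∘ f" := (comp g f) (at level 40, left associativity).

Record Functor (C D : Category) := MkFunctor {
  fo :> C -> D;
  fm : forall A B, hom A B -> hom (fo A) (fo B);
  fm_id : forall A, fm (idm A) = idm (fo A);
  fm_comp : forall A B E (g : hom B E) (f : hom A B),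
    fm (g ∘ f) = fm g ∘ fm f }.

Arguments fm {C D} _ {A B} _.

Section Functors.
Variable C : Category.

Program Definition idF : Functor C C := @MkFunctor C C (fun A => A) (fun _ _ f => f) _ _.
Next Obligation. by []. Qed.
Next Obligation. by []. Qed.

Program Definition compF (G F : Functor C C) : Functor C C :=
  @MkFunctor C C (fun A => G (F A)) (fun _ _ f => fm G (fm F f)) _ _.
Next Obligation. by move=> G F A /=; rewrite !fm_id. Qed.
Next Obligation. by move=> G F A B E g f /=; rewrite !fm_comp. Qed.

Fixpoint powF (F : Functor C C) (m : nat) : Functor C C :=
  if m is m'.+1 then compF F (powF F m') else idF.

Definition is_iso (A B : C) (f : hom A B) : Prop :=
  exists g : hom B A, g ∘ f = idm A /\ f ∘ g = idm B.

Definition is_equalizer (E A B : C) (e : hom E A) (f g : hom A B) : Prop :=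
  f ∘ e = g ∘ e /\
  forall (W : C) (h : hom W A), f ∘ h = g ∘ h -> exists! u : hom W E, e ∘ u = h.

Definition is_pullback (A B S P : C) (a : hom A S) (b : hom B S)
    (p1 : hom P A) (p2 : hom P B) : Prop :=
  a ∘ p1 = b ∘ p2 /\
  forall (W : C) (x : hom W A) (y : hom W B), a ∘ x = b ∘ y ->
    exists! u : hom W P, p1 ∘ u = x /\ p2 ∘ u = y.

(* [P] is the pullback over [A] of [n] copies of [p] (for [n = 0], [A] itself);
   [b] is its structure map to [A]. *)
Definition is_pullback_power (n : nat) (A E P : C) (p : hom E A)
    (b : hom P A) (pi : 'I_n -> hom P E) : Prop :=
  (forall i, p ∘ pi i = b) /\
  forall (W : C) (w : hom W A) (x : 'I_n -> hom W E), (forall i, p ∘ x i = w) ->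
    exists! u : hom W P, b ∘ u = w /\ forall i, pi i ∘ u = x i.

(* [z] is the sum [add ∘ ⟨x, y⟩] of the generalized elements [x], [y] of [E].
   Where [P] is the second pullback power of a map, [⟨x, y⟩] is unique, and it
   exists exactly when [x] and [y] have the same composite with that map. *)
Definition is_sum (E P : C) (pi : 'I_2 -> hom P E) (add : hom P E)
    (W : C) (x y z : hom W E) : Prop :=
  exists u : hom W P, [/\ pi ord0 ∘ u = x, pi ord_max ∘ u = y & add ∘ u = z].

End Functors.

(** * Tangent categories *)

(* Naturality of [+ : T_2 => T], the monoid laws of [p_A] in the slice over [A]
   and the additivity of [ℓ] and [c] are written with generalized elements.
   [ℓ] is a bundle morphism from [p_A] to [T p_A] over [0_A], and [c] one from
   [T p_A] to [p_{TA}] over the identity of [TA]. *)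
Record TangentStructure (C : Category) := MkTangentStructure {
  tT :> Functor C C;

  tp : forall A : C, hom (tT A) A;
  t0 : forall A : C, hom A (tT A);
  tl : forall A : C, hom (tT A) (tT (tT A));
  tc : forall A : C, hom (tT (tT A)) (tT (tT A));

  tpow : nat -> C -> C;
  tbase : forall n A, hom (tpow n A) A;
  tproj : forall n A, 'I_n -> hom (tpow n A) (tT A);
  tpow_power : forall n A, is_pullback_power (tp A) (tbase n A) (@tproj n A);
  tpow_preserved : forall m n A,
    is_pullback_power (fm (powF tT m) (tp A)) (fm (powF tT m) (tbase n A))
      (fun i => fm (powF tT m) (@tproj n A i));

  tadd : forall A : C, hom (tpow 2 A) (tT A);
  tsum := fun A : C => is_sum (@tproj 2 A) (tadd A);
  tTsum := fun A : C => is_sum (fun i => fm tT (@tproj 2 A i)) (fm tT (tadd A));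

  tp_nat : forall A B (f : hom A B), tp B ∘ fm tT f = f ∘ tp A;
  t0_nat : forall A B (f : hom A B), t0 B ∘ f = fm tT f ∘ t0 A;
  tl_nat : forall A B (f : hom A B), tl B ∘ fm tT f = fm tT (fm tT f) ∘ tl A;
  tc_nat : forall A B (f : hom A B),
    tc B ∘ fm tT (fm tT f) = fm tT (fm tT f) ∘ tc A;
  tadd_nat : forall A B (f : hom A B) W (x y z : hom W (tT A)),
    tsum x y z -> tsum (fm tT f ∘ x) (fm tT f ∘ y) (fm tT f ∘ z);

  tp_t0 : forall A, tp A ∘ t0 A = idm A;
  tp_tadd : forall A, tp A ∘ tadd A = tbase 2 A;
  tadd_0 : forall A W (x : hom W (tT A)), tsum x (t0 A ∘ tp A ∘ x) x;
  tadd_comm : forall A W (x y z : hom W (tT A)), tsum x y z -> tsum y x z;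
  tadd_assoc : forall A W (x y z xy yz s : hom W (tT A)),
    tsum x y xy -> tsum y z yz -> tsum xy z s -> tsum x yz s;

  tl_bundle : forall A, fm tT (tp A) ∘ tl A = t0 A ∘ tp A;
  tl_zero : forall A, tl A ∘ t0 A = fm tT (t0 A) ∘ t0 A;
  tl_add : forall A,
    tTsum (tl A ∘ tproj A ord0) (tl A ∘ tproj A ord_max) (tl A ∘ tadd A);

  tc_bundle : forall A, tp (tT A) ∘ tc A = fm tT (tp A);
  tc_zero : forall A, tc A ∘ fm tT (t0 A) = t0 (tT A);
  tc_add : forall A,
    tsum (tc A ∘ fm tT (tproj A ord0)) (tc A ∘ fm tT (tproj A ord_max))
      (tc A ∘ fm tT (tadd A));

  tc_invol : forall A, tc A ∘ tc A = idm (tT (tT A));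
  tc_tl : forall A, tc A ∘ tl A = tl A;
  tl_tl : forall A, fm tT (tl A) ∘ tl A = tl (tT A) ∘ tl A;
  tc_braid : forall A,
    fm tT (tc A) ∘ tc (tT A) ∘ fm tT (tc A) = tc (tT A) ∘ fm tT (tc A) ∘ tc (tT A);
  tc_tl_compat : forall A,
    tc (tT A) ∘ fm tT (tc A) ∘ tl (tT A) = fm tT (tl A) ∘ tc A;

  (* [v = T(+) ∘ ⟨ℓ π1, 0 π2⟩] *)
  t_universal : forall A, exists v : hom (tpow 2 A) (tT (tT A)),
    tTsum (tl A ∘ tproj A ord0) (t0 (tT A) ∘ tproj A ord_max) v /\
    is_equalizer v (fm tT (tp A)) (t0 A ∘ tp A ∘ tp (tT A)) }.

Arguments tp {C} t A.
Arguments t0 {C} t A.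
Arguments tl {C} t A.
Arguments tc {C} t A.
Arguments tadd {C} t A.
Arguments tpow {C} t n A.
Arguments tbase {C} t n A.
Arguments tproj {C} t {n} A _.
Arguments tsum {C} t {A W} x y z.
Arguments tTsum {C} t {A W} x y z.

Section TangentMorphism.
Variables (C D : Category) (T : TangentStructure C) (S : TangentStructure D).
Variables (H : Functor C D) (alpha : forall A : C, hom (H (T A)) (S (H A))).

Record is_tangent_morphism : Prop := {
  tm_nat : forall (A B : C) (g : hom A B),
    alpha B ∘ fm H (fm T g) = fm S (fm H g) ∘ alpha A;
  tm_p : forall A, tp S (H A) ∘ alpha A = fm H (tp T A);
  tm_0 : forall A, alpha A ∘ fm H (t0 T A) = t0 S (H A);
  (* the pairing hidden in [tsum] is [α_2 : H T_2 => S_2 H] *)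
  tm_add : forall A,
    tsum S (alpha A ∘ fm H (tproj T A ord0)) (alpha A ∘ fm H (tproj T A ord_max))
      (alpha A ∘ fm H (tadd T A));
  tm_l : forall A,
    tl S (H A) ∘ alpha A = fm S (alpha A) ∘ alpha (T A) ∘ fm H (tl T A);
  tm_c : forall A,
    tc S (H A) ∘ fm S (alpha A) ∘ alpha (T A)
    = fm S (alpha A) ∘ alpha (T A) ∘ fm H (tc T A) }.

Record is_strong_tangent_morphism : Prop := {
  tms_morphism : is_tangent_morphism;
  tms_iso : forall A, is_iso (alpha A);
  tms_powers : forall n A,
    is_pullback_power (fm H (tp T A)) (fm H (tbase T n A))
      (fun i => fm H (tproj T A i));
  tms_equalizers : forall A (v : hom (tpow T 2 A) (T (T A))),
    tTsum T (tl T A ∘ tproj T A ord0) (t0 T (T A) ∘ tproj T A ord_max) v ->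
    is_equalizer (fm H v) (fm H (fm T (tp T A)))
      (fm H (t0 T A ∘ tp T A ∘ tp T (T A))) }.

End TangentMorphism.

(** * Slice categories and base change *)

Section Slice.
Variable C : Category.

Record over_ob (S : C) := Over { over_dom : C; over_map : hom over_dom S }.

Definition over_hom (S : C) (Z Z' : over_ob S) :=
  {g : hom (over_dom Z) (over_dom Z') | over_map Z' ∘ g = over_map Z}.

Lemma over_hom_eq S (Z Z' : over_ob S) (g h : over_hom Z Z') :
  sval g = sval h -> g = h.
Proof.
case: g h => [g Hg] [h Hh] /= E; subst h.
by rewrite (Prop_irrelevance Hg Hh).
Qed.

Program Definition slice (S : C) : Category :=
  @MkCategory (over_ob S) (@over_hom S)
    (fun Z => exist _ (idm (over_dom Z)) _)
    (fun _ _ _ g f => exist _ (sval g ∘ sval f) _) _ _ _.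
Next Obligation. by move=> S Z /=; rewrite comp_idr. Qed.
Next Obligation. by move=> S A B D [g Hg] [f Hf] /=; rewrite comp_assoc Hg. Qed.
Next Obligation. by move=> S A B f; apply: over_hom_eq; rewrite /= comp_idl. Qed.
Next Obligation. by move=> S A B f; apply: over_hom_eq; rewrite /= comp_idr. Qed.
Next Obligation.
by move=> S A B D E h g f; apply: over_hom_eq; rewrite /= comp_assoc.
Qed.

Record pullback_along (S S' : C) (f : hom S' S) (Z : slice S) := PullbackAlong {
  pb_ob : C;
  pb_fst : hom pb_ob (over_dom Z);
  pb_snd : hom pb_ob S';
  pb_pullback : is_pullback (over_map Z) f pb_fst pb_snd }.

Section BaseChange.
Variables (S S' : C) (f : hom S' S) (pb : forall Z : slice S, pullback_along f Z).

Let bc (Z : slice S) : slice S' := Over (pb_snd (pb Z)).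

Lemma base_change_subproof (Z Z' : slice S) (g : hom Z Z') :
  exists h : hom (bc Z) (bc Z'),
    pb_fst (pb Z') ∘ sval h = sval g ∘ pb_fst (pb Z).
Proof.
have [_ /(_ _ (sval g ∘ pb_fst (pb Z)) (pb_snd (pb Z)))] := pb_pullback (pb Z').
have [e _] := pb_pullback (pb Z).
rewrite comp_assoc (proj2_sig g) e => /(_ erefl)[u [[u1 u2] _]].
by exists (exist _ u u2).
Qed.

Definition base_change_map (Z Z' : slice S) (g : hom Z Z') : hom (bc Z) (bc Z') :=
  sval (cid (base_change_subproof g)).

Lemma base_change_mapE (Z Z' : slice S) (g : hom Z Z') :
  pb_fst (pb Z') ∘ sval (base_change_map g) = sval g ∘ pb_fst (pb Z).
Proof. exact: (svalP (cid (base_change_subproof g))). Qed.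

Lemma base_change_map_uniq (Z Z' : slice S) (h h' : hom (bc Z) (bc Z')) :
  pb_fst (pb Z') ∘ sval h = pb_fst (pb Z') ∘ sval h' -> h = h'.
Proof.
move=> e; apply: over_hom_eq.
have [c] := pb_pullback (pb Z').
have s2 (k : hom (bc Z) (bc Z')) : pb_snd (pb Z') ∘ sval k = pb_snd (pb Z).
  exact: (proj2_sig k).
move=> /(_ _ (pb_fst (pb Z') ∘ sval h) (pb_snd (pb Z))).
rewrite comp_assoc c -comp_assoc s2 => /(_ erefl)[u [_ uu]].
by rewrite -(uu (sval h)) ?s2 // -(uu (sval h')) ?s2.
Qed.

(* The functor [Z ↦ Z ×_S S'] attached to a choice [pb] of pullbacks. *)
Program Definition base_change : Functor (slice S) (slice S') :=
  @MkFunctor (slice S) (slice S') bc base_change_map _ _.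
Next Obligation.
move=> A; apply: base_change_map_uniq.
by rewrite base_change_mapE /= comp_idl comp_idr.
Qed.
Next Obligation.
move=> A B E g f'; apply: base_change_map_uniq.
by rewrite base_change_mapE /= comp_assoc base_change_mapE -!comp_assoc base_change_mapE.
Qed.

End BaseChange.
End Slice.

(** * Locally ringed spaces and schemes *)

Record opens (X : topologicalType) := Opens { oset :> set X; oopen : open oset }.

(* The structure sheaf is indexed by all subsets, but only its values on open
   subsets matter: a sheaf [O] on the open subsets extends by [U ↦ O (U°)].
   The stalk at [x] is not built; a germ at [x] is represented by a section [s]
   on an open neighbourhood of [x], and [germ_unit s x] says that it is
   invertible. A ring is local iff it is nonzero and, for all [s], one of [s],
   [1 - s] is invertible. *)
Record RingedSpace := MkRingedSpace {
  rs_space :> topologicalType;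
  rs_O : set rs_space -> comPzRingType;
  rs_res : forall U V : set rs_space, V `<=` U -> {rmorphism rs_O U -> rs_O V};
  rs_res_id : forall (U : set rs_space) (h : U `<=` U) s, rs_res h s = s;
  rs_res_comp : forall (U V W : set rs_space)
    (h : V `<=` U) (k : W `<=` V) (l : W `<=` U) s,
    rs_res k (rs_res h s) = rs_res l s;
  rs_separated : forall (I : Type) (U : opens rs_space) (V : I -> opens rs_space)
    (h : forall i, V i `<=` U), U `<=` \bigcup_i V i ->
    forall s t : rs_O U, (forall i, rs_res (h i) s = rs_res (h i) t) -> s = t;
  rs_glue : forall (I : Type) (U : opens rs_space) (V : I -> opens rs_space)
    (h : forall i, V i `<=` U), U `<=` \bigcup_i V i ->
    forall s : forall i, rs_O (V i),
    (forall i j, rs_res (@subIsetl _ (V i) (V j)) (s i)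
               = rs_res (@subIsetr _ (V i) (V j)) (s j)) ->
    exists t : rs_O U, forall i, rs_res (h i) t = s i }.

Arguments rs_O {r} _.
Arguments rs_res {r U V} _.

Definition germ_unit (X : RingedSpace) (U : set X) (s : rs_O U) (x : X) : Prop :=
  exists (V : opens X) (h : V `<=` U), oset V x /\ exists t, rs_res h s * t = 1.

Record LRS := MkLRS {
  lrs_space :> RingedSpace;
  lrs_nonzero : forall (x : lrs_space) (U : opens lrs_space),
    oset U x -> (1 : rs_O U) <> 0;
  lrs_local : forall (x : lrs_space) (U : opens lrs_space) (s : rs_O U),
    oset U x -> germ_unit s x \/ germ_unit (1 - s) x }.

Definition preim_opens (X Y : topologicalType) (f : X -> Y) (fc : continuous f)
  (U : opens Y) : opens X :=
  Opens (proj1 (continuousP f) fc U (oopen U)).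

Record LRSHom (X Y : LRS) := MkLRSHom {
  lh_fun :> X -> Y;
  lh_cont : continuous lh_fun;
  lh_sharp : forall U : opens Y, {rmorphism rs_O U -> rs_O (lh_fun @^-1` U)};
  lh_natural : forall (U V : opens Y) (h : V `<=` U)
    (k : lh_fun @^-1` V `<=` lh_fun @^-1` U) s,
    lh_sharp V (rs_res h s) = rs_res k (lh_sharp U s);
  lh_local : forall (U : opens Y) (s : rs_O U) (x : X), oset U (lh_fun x) ->
    germ_unit (lh_sharp U s) x -> germ_unit s (lh_fun x) }.

Arguments lh_sharp {X Y} _ U.

Definition preim (X Y : LRS) (f : LRSHom X Y) (U : opens Y) : opens X :=
  preim_opens (@lh_cont _ _ f) U.

(* [b ↦ f^♯(b)|_W], for [W ⊆ f^{-1}(U)] *)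
Definition pull (X Y : LRS) (f : LRSHom X Y) (U : opens Y) (W : opens X)
  (h : W `<=` f @^-1` U) : {rmorphism rs_O U -> rs_O W} :=
  (rs_res h \o lh_sharp f U)%FUN.

Section LRSCategory.

Lemma rmorphism_eq (A B : comPzRingType) (f g : {rmorphism A -> B}) : f =1 g -> f = g.
Proof.
case: f g => [f [[f1] [f2]]] [g [[g1] [g2]]] /= e.
have {}e : f = g by apply/funext.
by subst g; congr (GRing.RMorphism.Pack (GRing.RMorphism.Class _ _));
  [congr (GRing.isNmodMorphism.Axioms_ _)|congr (GRing.isMonoidMorphism.Axioms_ _)];
  apply: Prop_irrelevance.
Qed.

Lemma opens_eq (X : topologicalType) (U V : opens X) : oset U = oset V -> U = V.
Proof.
by case: U V => [U oU] [V oV] /= e; subst V; rewrite (Prop_irrelevance oU oV).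
Qed.

Lemma LRSHom_eq (X Y : LRS) (f : X -> Y) c c' (s s' : forall U : opens Y,
    {rmorphism rs_O U -> rs_O (f @^-1` U)}) n n' l l' :
  (forall U a, s U a = s' U a) ->
  @MkLRSHom X Y f c s n l = @MkLRSHom X Y f c' s' n' l'.
Proof.
move=> e.
have {}e : s = s' by apply: functional_extensionality_dep => U; apply: rmorphism_eq.
subst s'.
by rewrite (Prop_irrelevance c c') (Prop_irrelevance n n') (Prop_irrelevance l l').
Qed.

Program Definition lrs_id (X : LRS) : LRSHom X X :=
  @MkLRSHom X X idfun _ (fun U => idfun) _ _.
Next Obligation. by move=> X x; exact: cvg_id. Qed.
Next Obligation.
move=> X U V h k s /=; congr (rs_res _ _); exact: Prop_irrelevance.
Qed.
Next Obligation. by []. Qed.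

Program Definition lrs_comp (X Y Z : LRS) (g : LRSHom Y Z) (f : LRSHom X Y) :
  LRSHom X Z :=
  @MkLRSHom X Z (g \o f)%FUN _
    (fun U => (lh_sharp f (preim g U) \o lh_sharp g U)%FUN) _ _.
Next Obligation.
by move=> X Y Z g f x; apply: continuous_comp; apply: lh_cont.
Qed.
Next Obligation.
move=> X Y Z g f U V h k s /=.
have k' : g @^-1` V `<=` g @^-1` U by move=> y; exact: h.
by rewrite (lh_natural h k') (@lh_natural _ _ f (preim g U) (preim g V) k' k).
Qed.
Next Obligation.
move=> X Y Z g f U s x /= Ux H; apply: (lh_local Ux).
exact: (@lh_local _ _ f (preim g U) _ x Ux H).
Qed.

Lemma lrs_comp_idl (X Y : LRS) (f : LRSHom X Y) : lrs_comp (lrs_id Y) f = f.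
Proof.
case: f => f c s n l; apply: (@LRSHom_eq _ _ f) => U a /=.
case: U a => U oU a.
have key (p q : open U) : s (Opens p) a = s (Opens q) a.
  by rewrite (Prop_irrelevance p q).
exact: (key (oopen (preim (lrs_id Y) (Opens oU))) oU).
Qed.

Lemma lrs_comp_idr (X Y : LRS) (f : LRSHom X Y) : lrs_comp f (lrs_id X) = f.
Proof. by case: f => f c s n l; apply: (@LRSHom_eq _ _ f). Qed.

Lemma lrs_comp_assoc (X Y Z W : LRS) (h : LRSHom Z W) (g : LRSHom Y Z)
    (f : LRSHom X Y) :
  lrs_comp h (lrs_comp g f) = lrs_comp (lrs_comp h g) f.
Proof.
apply: (@LRSHom_eq _ _ (h \o g \o f)%FUN) => U a /=.
set b := lh_sharp g _ _.
have key (p q : open (g @^-1` (h @^-1` U))) :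
    lh_sharp f (Opens p) b = lh_sharp f (Opens q) b.
  by rewrite (Prop_irrelevance p q).
exact: key.
Qed.

End LRSCategory.

Definition is_prime_ideal (R : comPzRingType) (I : set R) : Prop :=
  [/\ I 0, (forall a b, I a -> I b -> I (a + b)), (forall a b, I b -> I (a * b)),
      ~ I 1 & forall a b, I (a * b) -> I a \/ I b].

Section AffineOpens.
Variables (X : LRS) (U : opens X).

(* the preimage of the maximal ideal of the stalk at [x] *)
Definition point_prime (x : X) : set (rs_O U) := [set b | ~ germ_unit b x].

Definition basic_open (b : rs_O U) : set X := [set x | oset U x /\ germ_unit b x].

Lemma basic_open_sub (b : rs_O U) : basic_open b `<=` U.
Proof. by move=> x []. Qed.

(* [(U, O_X|_U)] is isomorphic to [Spec O_X(U)]: the map [x ↦ point_prime x] is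
   bijective onto the prime ideals, it is a homeomorphism (the [D(b)] form a
   basis of [U]), and [O_X(D(b))] is the localization [O_X(U)_b]. *)
Record is_affine : Prop := {
  affine_inj : forall x y, oset U x -> oset U y -> point_prime x = point_prime y -> x = y;
  affine_surj : forall I : set (rs_O U), is_prime_ideal I ->
    exists2 x, oset U x & point_prime x = I;
  affine_basis : forall (V : opens X) x, oset U x -> oset V x ->
    exists2 b : rs_O U, basic_open b x & basic_open b `<=` V;
  affine_unit : forall b : rs_O U, exists t, rs_res (@basic_open_sub b) b * t = 1;
  affine_frac : forall (b : rs_O U) (t : rs_O (basic_open b)), exists a n,
    t * rs_res (@basic_open_sub b) b ^+ n = rs_res (@basic_open_sub b) a;
  affine_kernel : forall b a : rs_O U, rs_res (@basic_open_sub b) a = 0 ->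
    exists n, b ^+ n * a = 0 }.

End AffineOpens.

Record Scheme := MkScheme {
  sch_lrs :> LRS;
  sch_cover : forall x : sch_lrs, exists2 U : opens sch_lrs, is_affine U & oset U x }.

Definition Sch : Category :=
  @MkCategory Scheme (fun X Y => LRSHom X Y) (fun X => lrs_id X)
    (fun _ _ _ g f => lrs_comp g f)
    (fun _ _ f => lrs_comp_idl f) (fun _ _ f => lrs_comp_idr f)
    (fun _ _ _ _ h g f => lrs_comp_assoc h g f).

Definition SchOver (S : Scheme) : Category := @slice Sch S.

(* underlying scheme, structure morphism, and underlying morphism of schemes *)
Definition usch (S : Scheme) (Z : SchOver S) : Scheme := over_dom Z.
Definition ustr (S : Scheme) (Z : SchOver S) : LRSHom (usch Z) S := over_map Z.
Definition umap (S : Scheme) (Z Z' : SchOver S) (g : hom Z Z') :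
  LRSHom (usch Z) (usch Z') := sval g.

(** * The Zariski tangent structure *)

Record is_derivation (A B R : comPzRingType) (phi : A -> B) (beta : B -> R)
    (d : B -> R) : Prop := {
  der_add : forall b b', d (b + b') = d b + d b';
  der_leibniz : forall b b', d (b * b') = beta b * d b' + beta b' * d b;
  der_scalar : forall a, d (phi a) = 0 }.

(* [(E, iota, d)] is [Sym_B(Ω^1_{B/A})], with [iota b] and [d b] the generators
   [b] and [db]: ring maps from it to [R] are pairs of a ring map [B -> R] and
   an [A]-derivation [B -> R] over it. *)
Definition is_sym_omega (A B E : comPzRingType) (phi : {rmorphism A -> B})
    (iota : {rmorphism B -> E}) (d : B -> E) : Prop :=
  is_derivation phi iota d /\
  forall (R : comPzRingType) (beta : {rmorphism B -> R}) (D : B -> R),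
    is_derivation phi beta D ->
    exists! h : {rmorphism E -> R},
      (forall b, h (iota b) = beta b) /\ (forall b, h (d b) = D b).

(* An affine piece [U = Spec B -> V = Spec A] of [Z -> S]. *)
Record affine_piece (S : Scheme) (Z : SchOver S) (V : opens S)
    (U : opens (usch Z)) : Prop := {
  piece_base : is_affine V;
  piece_total : is_affine U;
  piece_sub : U `<=` ustr Z @^-1` V }.

(* [zt_d U] is [b ↦ db], with values in the ring of [p^{-1}(U) ⊆ T_{Z/S}].
   [T_{Z/S}] is the relative spectrum of [Sym(Ω^1_{Z/S})]: over an affine piece
   [U], [p^{-1}(U)] is affine with ring [Sym_B(Ω^1_{B/A})].
   Equations between sections on provably equal open sets are stated after
   restriction to an arbitrary open [W] on which both sides make sense. In
   [zt_lift] and [zt_flip], [sharp pT (sharp p b)], [sharp pT (d b)],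
   [d (sharp p b)] and [d (d b)] are the symbols [b], [db], [δb], [δdb]. *)
Record ZariskiTangentStructure (S : Scheme) := MkZariskiTangentStructure {
  zt :> TangentStructure (SchOver S);
  zt_p := fun Z : SchOver S => umap (tp zt Z);
  zt_inv := fun (Z : SchOver S) (U : opens (usch Z)) => preim (zt_p Z) U;
  zt_d : forall (Z : SchOver S) (U : opens (usch Z)), rs_O U -> rs_O (zt_inv U);

  zt_affine : forall (Z : SchOver S) V (U : opens (usch Z)),
    affine_piece V U -> is_affine (zt_inv U);
  zt_sym : forall (Z : SchOver S) V (U : opens (usch Z)) (h : affine_piece V U),
    is_sym_omega (pull (piece_sub h)) (lh_sharp (zt_p Z) U) (@zt_d Z U);

  (* [T(g)] is dual to [b ↦ g^♯(b)], [db ↦ d(g^♯(b))] *)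
  zt_map : forall (Z Z' : SchOver S) (g : hom Z Z') V U V' U'
    (h : affine_piece (Z := Z) V U) (h' : affine_piece (Z := Z') V' U')
    (k : U `<=` umap g @^-1` U')
    (l : zt_inv U `<=` umap (fm zt g) @^-1` zt_inv U') b,
    pull l (lh_sharp (zt_p Z') U' b) = lh_sharp (zt_p Z) U (pull k b) /\
    pull l (zt_d b) = zt_d (pull k b);

  zt_zero : forall (Z : SchOver S) V U (h : affine_piece (Z := Z) V U)
    (W : opens (usch Z)) (k : W `<=` U)
    (l : W `<=` umap (t0 zt Z) @^-1` zt_inv U) b,
    pull l (lh_sharp (zt_p Z) U b) = rs_res k b /\ pull l (zt_d b) = 0;

  zt_add : forall (Z : SchOver S) V U (h : affine_piece (Z := Z) V U)
    (W : opens (usch (tpow zt 2 Z)))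
    (l : W `<=` umap (tadd zt Z) @^-1` zt_inv U)
    (l1 : W `<=` umap (tproj zt Z ord0) @^-1` zt_inv U)
    (l2 : W `<=` umap (tproj zt Z ord_max) @^-1` zt_inv U) b,
    pull l (lh_sharp (zt_p Z) U b) = pull l1 (lh_sharp (zt_p Z) U b) /\
    pull l (zt_d b) = pull l1 (zt_d b) + pull l2 (zt_d b);

  zt_lift : forall (Z : SchOver S) V U (h : affine_piece (Z := Z) V U)
    (W : opens (usch (zt Z))) (k : W `<=` zt_inv U)
    (l : W `<=` umap (tl zt Z) @^-1` zt_inv (zt_inv U)) b,
    [/\ pull l (lh_sharp (zt_p (zt Z)) (zt_inv U) (lh_sharp (zt_p Z) U b))
        = rs_res k (lh_sharp (zt_p Z) U b),
        pull l (lh_sharp (zt_p (zt Z)) (zt_inv U) (zt_d b)) = 0,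
        pull l (@zt_d (zt Z) (zt_inv U) (lh_sharp (zt_p Z) U b)) = 0 &
        pull l (@zt_d (zt Z) (zt_inv U) (zt_d b)) = rs_res k (zt_d b)];

  zt_flip : forall (Z : SchOver S) V U (h : affine_piece (Z := Z) V U)
    (W : opens (usch (zt (zt Z)))) (k : W `<=` zt_inv (zt_inv U))
    (l : W `<=` umap (tc zt Z) @^-1` zt_inv (zt_inv U)) b,
    [/\ pull l (lh_sharp (zt_p (zt Z)) (zt_inv U) (lh_sharp (zt_p Z) U b))
        = rs_res k (lh_sharp (zt_p (zt Z)) (zt_inv U) (lh_sharp (zt_p Z) U b)),
        pull l (lh_sharp (zt_p (zt Z)) (zt_inv U) (zt_d b))
        = rs_res k (@zt_d (zt Z) (zt_inv U) (lh_sharp (zt_p Z) U b)),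
        pull l (@zt_d (zt Z) (zt_inv U) (lh_sharp (zt_p Z) U b))
        = rs_res k (lh_sharp (zt_p (zt Z)) (zt_inv U) (zt_d b)) &
        pull l (@zt_d (zt Z) (zt_inv U) (zt_d b))
        = rs_res k (@zt_d (zt Z) (zt_inv U) (zt_d b))] }.

Arguments zt_inv {S} _ {Z} U.
Arguments zt_d {S} _ {Z U} _.

(** * The canonical comparison [T_{Z/Y} ×_Y X -> T_{Z ×_Y X / X}] *)

Section Comparison.
Variables (X Y : Scheme) (f : @hom Sch X Y).
Variable pb : forall Z : SchOver Y, pullback_along f Z.
Variables (TX : ZariskiTangentStructure X) (TY : ZariskiTangentStructure Y).

Let fst_ (Z : SchOver Y) : LRSHom (usch (base_change pb Z)) (usch Z) :=
  pb_fst (pb Z).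
Let snd_ (Z : SchOver Y) : LRSHom (usch (base_change pb Z)) X :=
  pb_snd (pb Z).

(* For [U = Spec B] in [Z] and [W = Spec A] in [X] over [V = Spec C] in [Y],
   [alpha] carries [T_{B/C} ×_V W] into the part of [T_{Z ×_Y X / X}] over
   [U ×_V W], and there it is dual to
   [b ⊗ a ↦ b ⊗ a], [d(b ⊗ a) ↦ db ⊗ a].
   As [zt_d] is only meaningful on affine pieces, the second condition is stated
   on the affine open subsets [U'] of [U ×_V W]; [U' = U ×_V W] is allowed. *)
Definition is_canonical_comparison
    (alpha : forall Z : SchOver Y, hom (base_change pb (TY Z)) (TX (base_change pb Z))) :
    Prop :=
  forall (Z : SchOver Y) (V : opens Y) (U : opens (usch Z)) (W : opens X),
    affine_piece V U -> is_affine W -> W `<=` (f : LRSHom X Y) @^-1` V ->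
    (forall t, oset (zt_inv TY U) (fst_ (TY Z) t) -> oset W (snd_ (TY Z) t) ->
       let z := umap (tp TX (base_change pb Z)) (umap (alpha Z) t) in
       oset U (fst_ Z z) /\ oset W (snd_ Z z)) /\
    (forall (U' : opens (usch (base_change pb Z)))
       (h1 : U' `<=` fst_ Z @^-1` U) (h2 : U' `<=` snd_ Z @^-1` W)
       (Q : opens (usch (base_change pb (TY Z))))
       (l : Q `<=` umap (alpha Z) @^-1` zt_inv TX U')
       (k1 : Q `<=` fst_ (TY Z) @^-1` zt_inv TY U)
       (k2 : Q `<=` snd_ (TY Z) @^-1` W)
       (b : rs_O U) (a : rs_O W),
       is_affine U' ->
       pull l (lh_sharp (umap (tp TX (base_change pb Z))) U' (pull h1 b * pull h2 a))
       = pull k1 (lh_sharp (umap (tp TY Z)) U b) * pull k2 a /\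
       pull l (zt_d TX (pull h1 b * pull h2 a))
       = pull k1 (zt_d TY b) * pull k2 a).

End Comparison.

Arguments is_canonical_comparison {X Y f} pb TX TY alpha.

(* Main.v *)
From HB Require Import structures.
From mathcomp Require Import all_boot all_algebra.
From mathcomp Require Import boolp classical_sets topology ring.
Require Import Defs.

(* A morphism [g : P -> Z] over [f : X -> Y] has a differential
   [T_f g : T_{P/X} -> T_{Z/Y}], dual to [b ↦ g^♯ b], [db ↦ d (g^♯ b)]; it is
   functorial and commutes with [0], [+], [ℓ] and [c], as one sees on generators.
   Let [q : Z ×_Y X -> Z] be the projection. Two morphisms [g, h] into
   [T_{Z ×_Y X / X}] over [X] that agree after [T_f q] are equal: they have the
   same composite [m] with [p], and [g^♯ ∘ d - h^♯ ∘ d] is a derivation along [m]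
   killing the sections of [Z] and [X]; it is a tangent vector, that is, a morphism
   from the square-zero thickening [Q[ε]] of the source [Q] to [Z ×_Y X], with the
   same composites to [Z] and [X] as the zero tangent vector, hence zero.
   The canonical comparison [α] satisfies [T_f q ∘ α = pr_1], so its inverse is
   induced by [T_f q] and the structure map, and each required equation may be
   checked after composition with [T_f q] or [T_f (T_f q)]. The powers and
   equalizers are preserved because base change is a right adjoint. *)

Set Implicit Arguments.
Unset Strict Implicit.
Unset Printing Implicit Defensive.

Import GRing.Theory.
Local Open Scope classical_set_scope.
Local Open Scope ring_scope.

(** * Sections and germs *)

(** The pullbacks [Z ×_Y X] are arbitrary ones, given only by their universal property in [Sch]; the
    ring of an affine open of [Z ×_Y X] is never identified with a tensor product. It is therefore
    not known here that sections of [Z ×_Y X] are generated by sections of [Z] and [X], and a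
    derivation cannot be shown to vanish by looking at such generators. This is why a difference of
    derivations is turned into a morphism, to which the universal property applies, and why the
    thickening has to be a scheme. Likewise tangent bundles are known only through their rings over
    affine pieces, and [d] is meaningful only there. Differentials and tangent vectors are thus
    glued from ring maps by [lrs_glue], which finds the points as prime ideals contracted from local
    rings and the comorphism from fractions. *)

Definition opensI (X : topologicalType) (U V : opens X) : opens X :=
  Opens (openI (oopen U) (oopen V)).

Lemma unit_lreg (R : comPzRingType) (u t a b : R) :
  u * t = 1 -> u * a = u * b -> a = b.
Proof.
move=> ut e; have : t * (u * a) = t * (u * b) by rewrite e.
by rewrite !mulrA [t * u]mulrC ut !mul1r.
Qed.

Lemma unit_expr (R : comPzRingType) (u t : R) n : u * t = 1 -> u ^+ n * t ^+ n = 1.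
Proof. by move=> ut; rewrite -exprMn_comm ?ut ?expr1n //; exact: mulrC. Qed.

Section RingedSpaces.
Variable X : RingedSpace.
Implicit Types U V W N : set X.

Lemma rs_res_irr U V (h k : V `<=` U) (s : rs_O U) : rs_res h s = rs_res k s.
Proof. by rewrite (Prop_irrelevance h k). Qed.

Lemma eq_sections (V : opens X) (s t : rs_O V) :
  (forall x, oset V x -> exists (N : opens X) (h : N `<=` V),
     oset N x /\ rs_res h s = rs_res h t) -> s = t.
Proof.
move=> H.
pose I := {x | oset V x}.
have /choice[N HN] : forall i : I, exists N : opens X, exists (h : N `<=` V),
    oset N (sval i) /\ rs_res h s = rs_res h t by move=> i; exact: H (svalP i).
have sub i : N i `<=` V by have [h _] := HN i.
apply: (@rs_separated X I V N sub).
  by move=> x Vx; exists (exist _ x Vx) => //; have [h []] := HN (exist _ x Vx).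
by move=> i; have [h [_ e]] := HN i; rewrite !(rs_res_irr (sub i) h).
Qed.

(** Descent for a section that is characterised by a property instead of being given on a cover:
    uniqueness supplies the agreement on overlaps. Inverses and the comorphism of a glued morphism
    are both obtained this way. *)
Lemma glue_sections (V : opens X) (P : forall N : opens X, rs_O N -> Prop) :
  (forall (N N' : opens X) (h : N' `<=` N) (s : rs_O N), P N s -> P N' (rs_res h s)) ->
  (forall (N : opens X) (s s' : rs_O N), P N s -> P N s' -> s = s') ->
  (forall x, oset V x -> exists2 N : opens X, oset N x /\ N `<=` V & exists s, P N s) ->
  exists s : rs_O V, forall (N : opens X) (h : N `<=` V) s', P N s' -> rs_res h s = s'.
Proof.
move=> Pr Pu Pe.
pose I := {x | oset V x}.
have /choice[N HN] : forall i : I, exists N : opens X, [/\ oset N (sval i), N `<=` V &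
    exists s, P N s] by move=> i; have [N [? ?] ?] := Pe _ (svalP i); exists N.
have sub i : N i `<=` V by have [] := HN i.
have ex i : exists s, P (N i) s by have [] := HN i.
pose s i := sval (cid (ex i)).
have Ps i : P (N i) (s i) by exact: svalP (cid (ex i)).
have cov : V `<=` \bigcup_i N i.
  by move=> x Vx; exists (exist _ x Vx) => //; have [] := HN (exist _ x Vx).
have [] := @rs_glue X I V N sub cov s.
  move=> i j; apply: (Pu (opensI (N i) (N j))); exact: Pr.
move=> t Ht; exists t => M hM s' Ps'.
apply: eq_sections => x Mx.
have [i _ Nix] := cov x (hM x Mx).
have k : opensI M (N i) `<=` M by exact: subIsetl.
exists (opensI M (N i)), k; split => //.
apply: (Pu (opensI M (N i))); last exact: Pr.
have k' : opensI M (N i) `<=` V by move=> y [/hM].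
have k2 : opensI M (N i) `<=` N i by exact: subIsetr.
by rewrite (rs_res_comp _ _ k') -(rs_res_comp (sub i) k2) Ht; exact: Pr.
Qed.

End RingedSpaces.

Section GermUnits.
Variable X : RingedSpace.

Lemma germ_unit_sub (U : set X) (s : rs_O U) x : germ_unit s x -> U x.
Proof. by move=> [V [h [Vx _]]]; exact: h. Qed.

Lemma germ_unit_nbhs (U : set X) (s : rs_O U) x : germ_unit s x ->
  exists N : opens X, oset N x /\ N `<=` [set y | germ_unit s y].
Proof.
move=> [V [h [Vx [t e]]]]; exists V; split=> // y Vy.
by exists V, h; split=> //; exists t.
Qed.

Lemma open_locally (A : set X) :
  (forall x, A x -> exists N : opens X, oset N x /\ N `<=` A) -> open A.
Proof.
move=> H; rewrite openE => x /H[N [Nx NA]].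
by rewrite /interior; apply: filterS NA _; exact: open_nbhs_nbhs (conj (oopen N) Nx).
Qed.

Lemma germ_unit_res (U : set X) (V : opens X) (h : V `<=` U) (s : rs_O U) x :
  oset V x -> germ_unit (rs_res h s) x <-> germ_unit s x.
Proof.
move=> Vx; split=> [[N [k [Nx [t e]]]]|[N [k [Nx [t e]]]]].
  have l : N `<=` U by move=> y /k/h.
  by exists N, l; split=> //; exists t; rewrite -(rs_res_comp h k).
have k1 : opensI V N `<=` V by exact: subIsetl.
have k2 : opensI V N `<=` N by exact: subIsetr.
have l : opensI V N `<=` U by move=> y /k1/h.
exists (opensI V N), k1; split=> //; exists (rs_res k2 t).
by rewrite (rs_res_comp h k1 l) -(rs_res_comp k k2) -rmorphM e rmorph1.
Qed.

Lemma germ_unitM (U : set X) (s t : rs_O U) x :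
  germ_unit (s * t) x <-> germ_unit s x /\ germ_unit t x.
Proof.
split=> [[N [k [Nx [w e]]]]|[[N [k [Nx [w e]]]] [M [l [Mx [v e']]]]]].
  rewrite rmorphM in e.
  split; exists N, k; split=> //; [exists (rs_res k t * w)|exists (rs_res k s * w)].
    by rewrite mulrA.
  by rewrite mulrA [rs_res k t * _]mulrC.
have k1 : opensI N M `<=` N by exact: subIsetl.
have k2 : opensI N M `<=` M by exact: subIsetr.
have k3 : opensI N M `<=` U by move=> y /k1/k.
exists (opensI N M), k3; split=> //; exists (rs_res k1 w * rs_res k2 v).
rewrite rmorphM mulrACA -{1}(rs_res_comp k k1) -(rs_res_comp l k2) -!rmorphM.
by rewrite e e' !rmorph1 mulr1.
Qed.

Lemma germ_unit_of_inv (U : opens X) (s t : rs_O U) x :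
  oset U x -> s * t = 1 -> germ_unit s x.
Proof.
move=> Ux e; exists U, (@subset_refl _ _); split=> //.
by exists (rs_res (@subset_refl _ _) t); rewrite -rmorphM e rmorph1.
Qed.

Lemma germ_unit1 (U : opens X) x : oset U x -> germ_unit (1 : rs_O U) x.
Proof. by move=> Ux; apply: (germ_unit_of_inv (t := 1)); rewrite ?mulr1. Qed.

Lemma germ_unitX (U : opens X) (s : rs_O U) n x : germ_unit s x -> germ_unit (s ^+ n) x.
Proof.
move=> H; elim: n => [|n IH]; first exact: germ_unit1 (germ_unit_sub H).
by rewrite exprS; apply/germ_unitM.
Qed.

(** Inverses are unique, so the local ones glue. *)
Lemma unit_of_germs (U : opens X) (s : rs_O U) :
  (forall x, oset U x -> germ_unit s x) -> exists t, s * t = 1.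
Proof.
move=> H; pose P (N : opens X) (w : rs_O N) :=
  exists h : N `<=` U, rs_res h s * w = 1.
have [||x Ux|t Ht] := @glue_sections X U P.
- move=> N N' h w [k e].
  have l : N' `<=` U by move=> y /h/k.
  by exists l; rewrite -(rs_res_comp k h) -rmorphM e rmorph1.
- move=> N w w' [k e] [k' e']; rewrite (rs_res_irr k' k) in e'.
  by apply: (unit_lreg e); rewrite e e'.
- by have [N [h [Nx [w e]]]] := H x Ux; exists N => //; exists w, h.
exists t; apply: eq_sections => x Ux.
have [N [h [Nx [w e]]]] := H x Ux; exists N, h; split=> //.
by rewrite rmorphM (Ht N h w) ?e ?rmorph1 //; exists h.
Qed.

Lemma basic_openP (U : opens X) (b : rs_O U) : open [set x | oset U x /\ germ_unit b x].
Proof.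
apply: open_locally => x [Ux /germ_unit_nbhs[N [Nx NA]]].
exists N; split=> // y /NA H; split=> //; exact: germ_unit_sub H.
Qed.

End GermUnits.

Definition opensD (X : LRS) (U : opens X) (b : rs_O U) : opens X :=
  @Opens X (basic_open b) (basic_openP b).

Lemma opensD_sub (X : LRS) (U : opens X) (b : rs_O U) : opensD b `<=` U.
Proof. exact: basic_open_sub. Qed.

Section LocalGerms.
Variables (X : LRS) (U : opens X).

Lemma germ_unit0 x : oset U x -> ~ germ_unit (0 : rs_O U) x.
Proof.
move=> Ux [N [h [Nx [t]]]]; rewrite rmorph0 mul0r => e.
by apply: (@lrs_nonzero X x N Nx); rewrite e.
Qed.

(** With [w] inverse to [s + t] near [x], one has [1 - s * w = t * w], and locality makes [s * w] or
    [t * w] a unit. *)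
Lemma germ_unitD (s t : rs_O U) x :
  germ_unit (s + t) x -> germ_unit s x \/ germ_unit t x.
Proof.
move=> [N [h [Nx [w]]]]; rewrite rmorphD mulrDl => e.
have [] := @lrs_local X x N (rs_res h s * w) Nx.
  by case/germ_unitM => /(germ_unit_res h _ Nx); left.
have -> : 1 - rs_res h s * w = rs_res h t * w by rewrite -e; ring.
by case/germ_unitM => /(germ_unit_res h _ Nx); right.
Qed.

End LocalGerms.

(** * Pulling sections back *)

Section Pull.
Variables (X Y : LRS) (f : LRSHom X Y).

Lemma pull_irr (U : opens Y) (W : opens X) (h k : W `<=` f @^-1` U) s :
  pull h s = pull k s.
Proof. by rewrite (Prop_irrelevance h k). Qed.

Lemma res_pull (U : opens Y) (W W' : opens X) (h : W `<=` f @^-1` U)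
  (k : W' `<=` W) (l : W' `<=` f @^-1` U) s : rs_res k (pull h s) = pull l s.
Proof. exact: rs_res_comp. Qed.

Lemma pull_res (U V : opens Y) (W : opens X) (h : W `<=` f @^-1` V)
  (k : V `<=` U) (l : W `<=` f @^-1` U) s : pull h (rs_res k s) = pull l s.
Proof.
have k' : f @^-1` V `<=` f @^-1` U by move=> x; exact: k.
rewrite /pull /= (lh_natural (V := V) k k'); exact: rs_res_comp.
Qed.

Lemma germ_unit_pull (U : opens Y) (W : opens X) (h : W `<=` f @^-1` U) s x :
  oset W x -> germ_unit (pull h s) x <-> germ_unit s (f x).
Proof.
move=> Wx; rewrite /pull /=; split.
  move=> /(@germ_unit_res X (f @^-1` U) W h _ x Wx).
  by apply: lh_local; exact: h.
move=> [N [k [Nx [t e]]]].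
have k' : f @^-1` N `<=` f @^-1` U by move=> z; exact: k.
apply/(@germ_unit_res X (f @^-1` U) W h _ x Wx).
exists (preim f N), k'; split=> //; exists (lh_sharp f N t).
by rewrite -(lh_natural k k') -rmorphM e rmorph1.
Qed.

End Pull.

Arguments pull : simpl never.

Lemma pull_comp (X Y Z : LRS) (g : LRSHom Y Z) (f : LRSHom X Y) (U : opens Z)
  (V : opens Y) (W : opens X) (h : W `<=` lrs_comp g f @^-1` U)
  (h1 : W `<=` f @^-1` V) (h2 : V `<=` g @^-1` U) s :
  pull h s = pull h1 (pull h2 s).
Proof.
have k : W `<=` f @^-1` preim g U by move=> x /h1/h2.
by rewrite [RHS](pull_res (V := V) (U := preim g U) h1 h2 k) (pull_irr h k).
Qed.

Lemma pull_id (X : LRS) (U W : opens X) (h : W `<=` lrs_id X @^-1` U) s :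
  pull h s = rs_res (h : W `<=` U) s.
Proof. by []. Qed.

Lemma pull_eq (X Y : LRS) (f g : LRSHom X Y) (U : opens Y) (W : opens X)
  (h : W `<=` f @^-1` U) (k : W `<=` g @^-1` U) s : f = g -> pull h s = pull k s.
Proof. by move=> e; subst g; exact: pull_irr. Qed.

(** * Affine opens *)

Lemma point_primeE (X : LRS) (U : opens X) x y :
  @point_prime X U x = point_prime y ->
  forall b : rs_O U, germ_unit b x <-> germ_unit b y.
Proof.
move=> e b; have E : (~ germ_unit b x) = (~ germ_unit b y) by rewrite -![~ _]/(point_prime _ b) e.
by split=> ?; apply: contrapT; [rewrite -E|rewrite E]; exact.
Qed.

Section AffineOpenProperties.
Variables (X : LRS) (U : opens X).
Hypothesis aU : is_affine U.
Implicit Types (D : set X) (b : rs_O U).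

(** The equation [D = basic_open b] is a hypothesis because one open set arises under several
    presentations, such as a basic open of [D(b)] or of a thickening, and the types of sections
    block rewriting the set itself. *)
Lemma affine_unit_on D (h : D `<=` U) b :
  D = basic_open b -> exists t, rs_res h b * t = 1.
Proof.
by move=> e; subst D; rewrite (rs_res_irr h (@basic_open_sub _ _ b)); exact: affine_unit.
Qed.

Lemma affine_frac_on D (h : D `<=` U) b : D = basic_open b ->
  forall t : rs_O D, exists a n, t * rs_res h b ^+ n = rs_res h a.
Proof.
move=> e; subst D => t; rewrite (Prop_irrelevance h (@basic_open_sub _ _ b)).
exact: affine_frac.
Qed.

Lemma affine_kernel_on D (h : D `<=` U) b a : D = basic_open b ->
  rs_res h a = 0 -> exists n, b ^+ n * a = 0.
Proof.
move=> e; subst D; rewrite (Prop_irrelevance h (@basic_open_sub _ _ b)).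
exact: affine_kernel.
Qed.

Lemma affine_pointE x y : oset U x -> oset U y ->
  (forall b, germ_unit b x <-> germ_unit b y) -> x = y.
Proof.
move=> Ux Uy H; apply: (affine_inj aU) => //.
by apply/seteqP; split=> b /= Hb /H.
Qed.

(** Since [a = r / b ^ n] and [b] is a unit on [D(b)], the elements [a] and [r] are units at the
    same points there. So basic opens of [D(b)] are basic opens of [U]. *)
Lemma opensD_opensD b (a : rs_O (opensD b)) (r : rs_O U) n :
  a * rs_res (@opensD_sub _ _ b) b ^+ n = rs_res (@opensD_sub _ _ b) r ->
  basic_open a = basic_open (b * r).
Proof.
move=> e; apply/seteqP; split=> x /= [].
  move=> Dx ax; have [Ux bx] := Dx; split=> //; apply/germ_unitM; split=> //.
  apply/(germ_unit_res (@opensD_sub _ _ b) r Dx); rewrite -e.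
  by apply/germ_unitM; split=> //; apply: germ_unitX; exact/germ_unit_res.
move=> Ux /germ_unitM[bx rx].
have Dx : oset (opensD b) x by [].
split=> //; move/(germ_unit_res (@opensD_sub _ _ b) r Dx): rx.
by rewrite -e => /germ_unitM[].
Qed.

Lemma affine_opensD b : is_affine (opensD b).
Proof.
pose D := opensD b; pose h := @opensD_sub _ _ b : D `<=` U.
have [bi bbi] := affine_unit_on h (erefl (basic_open b)).
have frac (t : rs_O D) := affine_frac_on h (erefl (basic_open b)) t.
have bx x : oset D x -> germ_unit (rs_res h b) x.
  by move=> Dx; apply/germ_unit_res => //; have [] := Dx.
have unitE (t : rs_O D) a n x : t * rs_res h b ^+ n = rs_res h a -> oset D x ->
    germ_unit t x <-> germ_unit a x.
  move=> e Dx; rewrite -(germ_unit_res h a Dx) -e; split=> [tx|/germ_unitM[]//].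
  by apply/germ_unitM; split=> //; apply: germ_unitX; exact: bx.
split.
- move=> x y Dx Dy e; apply: affine_pointE => [||c]; [exact: (@h x)|exact: (@h y)|].
  rewrite -(germ_unit_res h c Dx) -(germ_unit_res h c Dy).
  exact: (@point_primeE X D x y e).
- move=> I [I0 ID IM I1 Ip].
  (* The point sought is the one belonging to the contraction of [I] to [U]. It lies in [D(b)]:
     otherwise [I] would contain [b], which is invertible over [D(b)]. *)
  have [|x Ux ex] := affine_surj aU (I := [set r | I (rs_res h r)]).
    split=> /=; rewrite ?rmorph0 ?rmorph1 //.
    - by move=> r s; rewrite rmorphD; exact: ID.
    - by move=> r s; rewrite rmorphM; exact: IM.
    - by move=> r s; rewrite rmorphM; exact: Ip.
  have Hx r : ~ germ_unit r x <-> I (rs_res h r).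
    have : @point_prime X U x r = I (rs_res h r) by rewrite ex.
    by rewrite /point_prime /= => ->.
  have Dx : oset D x.
    split=> //; apply: contrapT => /Hx /(IM bi); by rewrite mulrC bbi.
  exists x => //; apply/seteqP; split=> t; have [a [n e]] := frac t.
    rewrite /point_prime /= (unitE _ _ _ _ e Dx) => /Hx; rewrite -e => H.
    have := IM (bi ^+ n) _ H; rewrite mulrCA [bi ^+ n * _]mulrC.
    by rewrite (unit_expr n bbi) mulr1.
  move=> It; rewrite /point_prime /= (unitE _ _ _ _ e Dx); apply/Hx.
  by rewrite -e mulrC; exact: IM.
- move=> V x Dx Vx; have [c [Ux cx] cV] := affine_basis aU (h _ Dx) Vx.
  exists (rs_res h c); first by split=> //; apply/germ_unit_res.
  by move=> y [Dy /(germ_unit_res h c Dy) cy]; apply: cV; split=> //; exact: (@h y).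
- move=> t; apply: (@unit_of_germs X (opensD t)) => x Dx.
  by apply/(@germ_unit_res X _ (opensD t)) => //; have [] := Dx.
- move=> t s; have [a [n e]] := frac t.
  have E := opensD_opensD e.
  set k := @basic_open_sub _ _ t.
  have l : basic_open t `<=` U by move=> x /k/h.
  have [c [m e2]] := affine_frac_on l E s.
  (* From [t = a / b ^ n] and [s (b a) ^ m = c] follows [s t ^ m = c / b ^ (n m + m)], and [bi] is
     the inverse of [b] over [D(b)]. *)
  exists (rs_res h c * bi ^+ (n * m + m)), m.
  have hk r : rs_res l r = rs_res k (rs_res h r) by rewrite (rs_res_comp h k l).
  rewrite rmorphM -hk -e2 rmorphM exprMn_comm; last exact: mulrC.
  rewrite !hk -e rmorphM exprMn_comm; last exact: mulrC.
  rewrite -!rmorphXn /= -exprM -!mulrA; congr (_ * _).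
  rewrite -!rmorphM; congr (rs_res k _).
  have := unit_expr (n * m + m) bbi; rewrite exprD.
  set B1 := _ ^+ (n * m); set B2 := _ ^+ m => E1.
  by rewrite !rmorphXn -[LHS]mulr1 -E1 /B1 /B2; ring.
- move=> t s; set k := @basic_open_sub _ _ t => s0.
  have [a [n e]] := frac t; have E := opensD_opensD e.
  have [c [m e2]] := frac s.
  have l : basic_open t `<=` U by move=> x /k/h.
  have hk r : rs_res l r = rs_res k (rs_res h r) by rewrite (rs_res_comp h k l).
  have [|q q0] := affine_kernel_on (h := l) (a := c) E.
    by rewrite hk -e2 rmorphM s0 mul0r.
  (* Over [D(b)], substituting the two fractions into [(b a) ^ q c = 0] leaves [t ^ q s] times a
     power of [b], which is cancelled. *)
  exists q; have := congr1 (rs_res h) q0.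
  rewrite rmorph0 rmorphM rmorphXn rmorphM -e -e2 => H.
  apply: (unit_lreg (unit_expr (q + n * q + m) bbi)); rewrite mulr0 -[RHS]H.
  rewrite !exprD !exprMn_comm; try exact: mulrC.
  by rewrite -exprM; ring.
Qed.

End AffineOpenProperties.

Lemma affine_basis_scheme (X : Scheme) (V : opens X) x : oset V x ->
  exists U : opens X, [/\ is_affine U, oset U x & U `<=` V].
Proof.
move=> Vx; have [U aU Ux] := sch_cover x.
have [b bx bV] := affine_basis aU Ux Vx.
by exists (opensD b); split=> //; exact: affine_opensD.
Qed.

(** * Morphisms into schemes *)

Lemma affine_local_frac (Y : LRS) (A O : opens Y) (s : rs_O O) y :
  is_affine A -> oset A y -> oset O y ->
  exists (b a : rs_O A) (n : nat) (h : opensD b `<=` O),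
    oset (opensD b) y /\
    rs_res h s * rs_res (@opensD_sub _ _ b) b ^+ n = rs_res (@opensD_sub _ _ b) a.
Proof.
move=> aA Ay Oy; have [b Dy bO] := affine_basis aA Ay Oy.
have [a [n e]] := affine_frac_on aA (@opensD_sub _ _ b) erefl (rs_res bO s).
by exists b, a, n, bO.
Qed.

(** A point of an affine open is known from the sections that are units at it, so the underlying
    maps agree. A section over an arbitrary open set is locally a fraction [a / b ^ n] of sections
    of [U], and the pullback of [b] can be cancelled where it is a unit. *)
Lemma lrs_hom_eq (X Y : LRS) (g h : LRSHom X Y) :
  (forall t : X, exists (U : opens Y) (W : opens X) (l : W `<=` g @^-1` U)
     (l' : W `<=` h @^-1` U), [/\ is_affine U, oset W t & forall b, pull l b = pull l' b]) ->
  g = h.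
Proof.
move=> H.
have fe : g =1 h.
  move=> t; have [U [W [l [l' [aU Wt e]]]]] := H t.
  apply: (affine_pointE aU) (l t Wt) (l' t Wt) _ => b.
  by rewrite -(germ_unit_pull l b Wt) -(germ_unit_pull l' b Wt) e.
have loc (O : opens Y) (s : rs_O O) t : oset O (g t) ->
    exists (N : opens X) (k : N `<=` g @^-1` O) (k' : N `<=` h @^-1` O),
      oset N t /\ pull k s = pull k' s.
  move=> Ot; have [U [W [l [l' [aU Wt e]]]]] := H t.
  have [b [a [n [bO [Dt eb]]]]] := affine_local_frac s aU (l t Wt) Ot.
  pose N := opensI W (preim g (opensD b)).
  have NW : N `<=` W by exact: subIsetl.
  have Nb : N `<=` g @^-1` opensD b by exact: subIsetr.
  have Nb' : N `<=` h @^-1` opensD b by move=> y /Nb; rewrite /preimage /= fe.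
  have NO : N `<=` g @^-1` O by move=> y /Nb/bO.
  have NO' : N `<=` h @^-1` O by move=> y /Nb'/bO.
  have NU : N `<=` g @^-1` U by move=> y /NW/l.
  have NU' : N `<=` h @^-1` U by move=> y /NW/l'.
  exists N, NO, NO'; split=> //.
  have {}e c : pull NU c = pull NU' c by rewrite -(res_pull l NW NU) e (res_pull l' NW).
  have Hs (F : LRSHom X Y) (k1 : N `<=` F @^-1` opensD b) (k2 : N `<=` F @^-1` O)
      (k3 : N `<=` F @^-1` U) : pull k3 b ^+ n * pull k2 s = pull k3 a.
    have := congr1 (pull k1) eb.
    by rewrite mulrC rmorphM rmorphXn !(pull_res k1 (@opensD_sub _ _ b) k3) (pull_res k1 bO k2).
  have [|w ww] := unit_of_germs (s := pull NU b).
    by move=> y Ny; apply/germ_unit_pull => //; have [] := Nb _ Ny.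
  apply: (unit_lreg (unit_expr n ww)).
  by rewrite (Hs g Nb) [X in _ = X ^+ n * _]e (Hs h Nb') e.
case: g h {H} fe loc => g gc gs gn gl [h hc hs hn hl] /= /funext E.
subst h => loc; apply: LRSHom_eq => O s.
apply: (@eq_sections X (preim_opens gc O)) => t Ot.
have [N [k [k' [Nt e]]]] := loc O s t Ot.
by exists N, k; split=> //; rewrite [RHS](rs_res_irr k k').
Qed.

Section RMorphismOf.
Variables (A B : comPzRingType) (f : A -> B).
Hypotheses (fD : {morph f : a b / a + b}) (fM : {morph f : a b / a * b}) (f1 : f 1 = 1).

(** The proofs are arguments so that the instances declared on this head symbol can recover them. *)
Definition rmorphism_fun of {morph f : a b / a + b} & {morph f : a b / a * b} & f 1 = 1 := f.

Let fB : zmod_morphism f.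
Proof.
have f0 : f 0 = 0 by apply: (addIr (f 0)); rewrite -fD !add0r.
by move=> a b; apply: (addIr (f b)); rewrite -fD !subrK.
Qed.

HB.instance Definition _ := GRing.isZmodMorphism.Build A B (rmorphism_fun fD fM f1) fB.
HB.instance Definition _ :=
  GRing.isMonoidMorphism.Build A B (rmorphism_fun fD fM f1) (conj f1 fM).

Definition rmorphism_of : {rmorphism A -> B} := rmorphism_fun fD fM f1.

End RMorphismOf.

(** * Gluing a morphism from ring maps on affine opens of the target *)

Section GlueMorphism.
Variables (Q P : LRS) (I : Type) (A : I -> opens P) (W : I -> opens Q).
Variable phi : forall i, {rmorphism rs_O (A i) -> rs_O (W i)}.
Hypothesis A_affine : forall i, is_affine (A i).
Hypothesis W_cover : forall t, exists i, oset (W i) t.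
Hypothesis directed : forall i j t, oset (W i) t -> oset (W j) t ->
  exists k (ai : A k `<=` A i) (aj : A k `<=` A j) (wi : W k `<=` W i) (wj : W k `<=` W j),
    [/\ oset (W k) t, forall r, phi k (rs_res ai r) = rs_res wi (phi i r) &
        forall r, phi k (rs_res aj r) = rs_res wj (phi j r)].

(** As the stalk of [Q] at [t] is local, the sections whose image is not a unit at [t] form a prime
    ideal, and the affine open [A i] has a point for it. *)
Lemma glue_point_in i t : oset (W i) t -> exists y, oset (A i) y /\
  forall b : rs_O (A i), germ_unit b y <-> germ_unit (phi i b) t.
Proof.
move=> Wt; have [|y Ay E] := affine_surj (A_affine i)
    (I := [set b | ~ germ_unit (phi i b) t]).
  split=> /=.
  - by rewrite rmorph0; exact: germ_unit0.
  - by move=> a b Ha Hb; rewrite rmorphD => /germ_unitD[].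
  - by move=> a b Hb; rewrite rmorphM => /germ_unitM[].
  - by rewrite rmorph1 => /(_ (germ_unit1 Wt)).
  - move=> a b; rewrite rmorphM => H; apply: contrapT => /not_orP[/contrapT Ha /contrapT Hb].
    by apply: H; apply/germ_unitM.
exists y; split=> // b.
have : (@point_prime P (A i) y b) = (~ germ_unit (phi i b) t) by rewrite E.
by rewrite /point_prime /= => e; split=> ?; apply: contrapT; [rewrite -e|rewrite e]; exact.
Qed.

(** The point must not depend on [i]: two members around [t] are compared through a third one below
    both, whose point induces both primes. *)
Lemma glue_point t : exists y, forall i, oset (W i) t -> oset (A i) y /\
  forall b : rs_O (A i), germ_unit b y <-> germ_unit (phi i b) t.
Proof.
have [i0 Wi0] := W_cover t.
have [y [Ay Hy]] := glue_point_in Wi0; exists y => i Wi.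
have [k [a0 [ai [w0 [wi [Wk e0 ei]]]]]] := directed Wi0 Wi.
have [z [Az Hz]] := glue_point_in Wk.
have refine j (aj : A k `<=` A j) (wj : W k `<=` W j) :
    (forall r, phi k (rs_res aj r) = rs_res wj (phi j r)) -> forall b : rs_O (A j),
    germ_unit b z <-> germ_unit (phi j b) t.
  by move=> e b; rewrite -(germ_unit_res aj b Az) Hz e; exact: germ_unit_res.
have -> : y = z.
  apply: (affine_pointE (A_affine i0)) => // [|b]; first exact: (@a0 z).
  by rewrite Hy (refine _ _ _ e0).
by split; [exact: (@ai z)|exact: refine ei].
Qed.

Let x t := sval (cid (glue_point t)).
Let xA i t : oset (W i) t -> oset (A i) (x t).
Proof. by move=> /(svalP (cid (glue_point t)))[]. Qed.
Let xE i t (b : rs_O (A i)) : oset (W i) t -> germ_unit b (x t) <-> germ_unit (phi i b) t.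
Proof. by move=> /(svalP (cid (glue_point t)))[_ ->]. Qed.

Let x_cont : continuous x.
Proof.
apply/continuousP => O oO; apply: open_locally => t Ot.
have [i Wt] := W_cover t.
have [b [Ax bx] bO] := affine_basis (A_affine i) (xA Wt) (Ot : oset (Opens oO) (x t)).
exists (opensD (phi i b)); split; first by split=> //; exact/xE.
by move=> t' [Wt' Ht']; apply: bO; split; [exact: xA|exact/xE].
Qed.

Let xpre (O : opens P) : opens Q := preim_opens x_cont O.

(* [sigma] is compatible with every presentation [s = a / b ^ n] of [s] on a
   basic open subset of one of the [A i]. *)
Let rep (O : opens P) (s : rs_O O) (V : opens Q) (sigma : rs_O V) : Prop :=
  forall i (b a : rs_O (A i)) n (h : opensD b `<=` O),
    rs_res h s * rs_res (@opensD_sub _ _ b) b ^+ n = rs_res (@opensD_sub _ _ b) a ->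
  forall (N : opens Q) (v : N `<=` V) (w : N `<=` W i), N `<=` x @^-1` opensD b ->
    rs_res v sigma * rs_res w (phi i b) ^+ n = rs_res w (phi i a).

Let unit_on i (b : rs_O (A i)) (N : opens Q) (w : N `<=` W i) :
  N `<=` x @^-1` opensD b -> exists u, rs_res w (phi i b) * u = 1.
Proof.
move=> Nb; apply: unit_of_germs => t Nt.
have [_ bx] := Nb t Nt.
by apply/(germ_unit_res w) => //; apply/xE => //; exact: w.
Qed.

(* Two presentations of [s] give equal fractions on a common refinement, because
   the kernel of restriction to a basic open is annihilated by a power. *)
Let frac_compat (O : opens P) (s : rs_O O) i j (b a : rs_O (A i)) n (h : opensD b `<=` O)
    (b' a' : rs_O (A j)) n' (h' : opensD b' `<=` O) :
  rs_res h s * rs_res (@opensD_sub _ _ b) b ^+ n = rs_res (@opensD_sub _ _ b) a ->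
  rs_res h' s * rs_res (@opensD_sub _ _ b') b' ^+ n' = rs_res (@opensD_sub _ _ b') a' ->
  forall (N : opens Q) (w : N `<=` W i) (w' : N `<=` W j),
    N `<=` x @^-1` opensD b -> N `<=` x @^-1` opensD b' ->
    rs_res w (phi i a) * rs_res w' (phi j b') ^+ n' =
    rs_res w' (phi j a') * rs_res w (phi i b) ^+ n.
Proof.
move=> e e' N w w' Nb Nb'; apply: eq_sections => t Nt.
have [k [ai [aj [wi [wj [Wk ei ej]]]]]] := directed (w _ Nt) (w' _ Nt).
have NM : opensI N (W k) `<=` N by exact: subIsetl.
have wM : opensI N (W k) `<=` W k by exact: subIsetr.
exists (opensI N (W k)), NM; split=> //.
(* Kernels are controlled only within one affine open, so both fractions are moved to [A k], where
   [D(c)] lies in both basic opens. *)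
pose c := rs_res ai b * rs_res aj b'.
have Dk : opensD c `<=` A k by exact: opensD_sub.
have Db : opensD c `<=` opensD b.
  by move=> y [Ay /germ_unitM[by1 _]]; split; [exact: (@ai y)|apply/(germ_unit_res ai b Ay)].
have Db' : opensD c `<=` opensD b'.
  by move=> y [Ay /germ_unitM[_ by1]]; split; [exact: (@aj y)|apply/(germ_unit_res aj b' Ay)].
have DO : opensD c `<=` O by move=> y /Db/h.
have Di : opensD c `<=` A i by move=> y /Dk/ai.
have Dj : opensD c `<=` A j by move=> y /Dk/aj.
have E : rs_res DO s * rs_res Di b ^+ n = rs_res Di a.
  have := congr1 (rs_res Db) e.
  by rewrite rmorphM rmorphXn !(rs_res_comp (@opensD_sub _ _ b) Db Di) (rs_res_comp h Db DO).
have E' : rs_res DO s * rs_res Dj b' ^+ n' = rs_res Dj a'.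
  have := congr1 (rs_res Db') e'.
  by rewrite rmorphM rmorphXn !(rs_res_comp (@opensD_sub _ _ b') Db' Dj) (rs_res_comp h' Db' DO).
pose z := rs_res ai a * rs_res aj b' ^+ n' - rs_res aj a' * rs_res ai b ^+ n.
have [|m z0] := affine_kernel_on (A_affine k) (h := Dk) (a := z) (erefl (basic_open c)).
  rewrite rmorphB !rmorphM !rmorphXn !(rs_res_comp ai Dk Di) !(rs_res_comp aj Dk Dj).
  by rewrite -E -E'; ring.
have := congr1 (fun u => rs_res wM (phi k u)) z0.
rewrite !rmorph0 !(rmorphM, rmorphXn, rmorphB) !ei !ej.
have wMi : opensI N (W k) `<=` W i by move=> y /NM/w.
have wMj : opensI N (W k) `<=` W j by move=> y /NM/w'.
rewrite !(rs_res_comp wi wM wMi) !(rs_res_comp wj wM wMj).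
rewrite !(rs_res_comp w NM wMi) !(rs_res_comp w' NM wMj).
have [|u uu] := @unit_on i b (opensI N (W k)) wMi; first by move=> y /NM/Nb.
have [|u' uu'] := @unit_on j b' (opensI N (W k)) wMj; first by move=> y /NM/Nb'.
move=> H; apply/subr0_eq/(unit_lreg (unit_expr m uu))/(unit_lreg (unit_expr m uu')).
by rewrite !mulr0 mulrA -exprMn_comm ?[_ * rs_res wMi _]mulrC //; exact: mulrC.
Qed.

Let local_frac (O : opens P) (s : rs_O O) t : oset O (x t) ->
  exists i (b a : rs_O (A i)) n (h : opensD b `<=` O) (N : opens Q),
    [/\ oset N t, N `<=` W i, N `<=` x @^-1` opensD b &
        rs_res h s * rs_res (@opensD_sub _ _ b) b ^+ n = rs_res (@opensD_sub _ _ b) a].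
Proof.
move=> Ot; have [i Wt] := W_cover t.
have [b [a [n [h [Dx e]]]]] := affine_local_frac s (A_affine i) (xA Wt) Ot.
exists i, b, a, n, h, (opensI (W i) (xpre (opensD b))).
split=> //; by [split|move=> y []].
Qed.

Let rep_uniq (O : opens P) (s : rs_O O) (N : opens Q) (tau tau' : rs_O N) :
  N `<=` xpre O -> rep s tau -> rep s tau' -> tau = tau'.
Proof.
move=> k H H'; apply: eq_sections => t Nt.
have [i [b [a [n [h [M [Mt Mi Mb e]]]]]]] := local_frac s (k _ Nt).
have v : opensI N M `<=` N by exact: subIsetl.
have w : opensI N M `<=` W i by move=> y [_ /Mi].
have MB : opensI N M `<=` x @^-1` opensD b by move=> y [_ /Mb].
exists (opensI N M), v; split=> //.
have [u uu] := unit_on w MB.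
apply: (unit_lreg (unit_expr n uu)); rewrite [LHS]mulrC [RHS]mulrC.
by rewrite (H _ _ _ _ _ e _ _ _ MB) (H' _ _ _ _ _ e _ _ _ MB).
Qed.

(** Near [t] the value is [phi(a) / phi(b) ^ n] for one presentation of [s]; by [frac_compat] it
    fits every other presentation. *)
Let rep_local (O : opens P) (s : rs_O O) t : oset O (x t) ->
  exists2 N : opens Q, oset N t /\ N `<=` xpre O & exists tau : rs_O N, rep s tau.
Proof.
move=> Ot; have [i [b [a [n [h [N [Nt Ni Nb e]]]]]]] := local_frac s Ot.
exists N; first by split=> // y /Nb/h.
have [u uu] := unit_on Ni Nb.
exists (rs_res Ni (phi i a) * u ^+ n) => j b' a' n' h' e' M v w Mb'.
have wi : M `<=` W i by move=> y /v/Ni.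
have Mb : M `<=` x @^-1` opensD b by move=> y /v/Nb.
have := frac_compat e e' wi w Mb Mb'.
rewrite rmorphM rmorphXn (rs_res_comp Ni v wi) mulrAC => ->.
have uM := congr1 (rs_res v) uu.
rewrite rmorphM rmorph1 (rs_res_comp Ni v wi) in uM.
by rewrite -mulrA (unit_expr n uM) mulr1.
Qed.

Let sharp_ex (O : opens P) (s : rs_O O) :
  exists sigma : rs_O (xpre O), rep s sigma.
Proof.
have [||t Ot|sigma Hs] := @glue_sections Q (xpre O)
    (fun N tau => N `<=` xpre O /\ rep s tau).
- move=> N N' h tau [k H]; split=> [t /h/k//|i b a n l e M v w Mb].
  have v' : M `<=` N by move=> t /v/h.
  by rewrite (rs_res_comp h v v'); exact: H e _ _ _ Mb.
- by move=> N tau tau' [k H] [_ H']; exact: rep_uniq k H H'.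
- by have [N [Nt NO] [tau H]] := rep_local s Ot; exists N => //; exists tau.
exists sigma => i b a n h e N v w Nb; apply: eq_sections => t Nt.
have [N' [Nt' NO'] [tau rt]] := rep_local s (v _ Nt).
have M1 : opensI N N' `<=` N by exact: subIsetl.
have M2 : opensI N N' `<=` N' by exact: subIsetr.
have MW : opensI N N' `<=` W i by move=> y [/w].
have MO : opensI N N' `<=` xpre O by move=> y [/v].
exists (opensI N N'), M1; split=> //.
rewrite rmorphM rmorphXn !(rs_res_comp w M1 MW) (rs_res_comp v M1 MO).
rewrite -(rs_res_comp NO' M2 MO) (Hs _ NO' tau (conj NO' rt)).
by apply: (rt _ _ _ _ _ e) => y [/Nb].
Qed.

Let sharp (O : opens P) (s : rs_O O) : rs_O (xpre O) := sval (cid (sharp_ex s)).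
Let sharpP (O : opens P) (s : rs_O O) : rep s (sharp s).
Proof. exact: (svalP (cid (sharp_ex s))). Qed.

Let sharpE (O : opens P) (s : rs_O O) i (b a : rs_O (A i)) n (h : opensD b `<=` O) :
  rs_res h s * rs_res (@opensD_sub _ _ b) b ^+ n = rs_res (@opensD_sub _ _ b) a ->
  forall (N : opens Q) (v : N `<=` xpre O) (w : N `<=` W i), N `<=` x @^-1` opensD b ->
    rs_res v (sharp s) * rs_res w (phi i b) ^+ n = rs_res w (phi i a).
Proof. exact: sharpP. Qed.

Let local_frac2 (O : opens P) (s s' : rs_O O) t : oset O (x t) ->
  exists i (b a a' : rs_O (A i)) n (h : opensD b `<=` O) (N : opens Q),
    [/\ oset N t, N `<=` W i, N `<=` x @^-1` opensD b,
        rs_res h s * rs_res (@opensD_sub _ _ b) b ^+ n = rs_res (@opensD_sub _ _ b) a &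
        rs_res h s' * rs_res (@opensD_sub _ _ b) b ^+ n = rs_res (@opensD_sub _ _ b) a'].
Proof.
move=> Ot; have [i [b [a [n [h [N [Nt Ni Nb e]]]]]]] := local_frac s Ot.
have [a' [n' e']] := affine_frac_on (A_affine i) (@opensD_sub _ _ b) erefl (rs_res h s').
(* The second section is presented over the basic open already found for the first, so
   [b ^ (n + n')] is a common denominator. *)
exists i, b, (a * b ^+ n'), (a' * b ^+ n), (n + n')%N, h, N.
split=> //; rewrite exprD ?[_ ^+ n * _]mulrC mulrA -?e -?e' rmorphM rmorphXn -?e -?e'; ring.
Qed.

Let sharp_eq (O : opens P) (sigma tau : rs_O (xpre O)) :
  (forall t, oset O (x t) -> exists i (b : rs_O (A i)) n (h : opensD b `<=` O) (N : opens Q)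
     (w : N `<=` W i) (v : N `<=` xpre O), [/\ oset N t, N `<=` x @^-1` opensD b &
     rs_res v sigma * rs_res w (phi i b) ^+ n = rs_res v tau * rs_res w (phi i b) ^+ n]) ->
  sigma = tau.
Proof.
move=> H; apply: eq_sections => t Ot.
have [i [b [n [h [N [w [v [Nt Nb e]]]]]]]] := H t Ot.
exists N, v; split=> //; have [u uu] := unit_on w Nb.
by apply: (unit_lreg (unit_expr n uu)); rewrite [LHS]mulrC [RHS]mulrC.
Qed.

Let sharpD O : {morph @sharp O : s s' / s + s'}.
Proof.
move=> s s'; apply: sharp_eq => t Ot.
have [i [b [a [a' [n [h [N [Nt Ni Nb e e']]]]]]]] := local_frac2 s s' Ot.
have v : N `<=` xpre O by move=> y /Nb/h.
exists i, b, n, h, N, Ni, v; split=> //.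
rewrite (sharpE (a := a + a') (h := h) _ _ _ Nb); last first.
  by rewrite !rmorphD mulrDl e e'.
by rewrite !rmorphD mulrDl (sharpE e v Ni Nb) (sharpE e' v Ni Nb).
Qed.

Let sharpM O : {morph @sharp O : s s' / s * s'}.
Proof.
move=> s s'; apply: sharp_eq => t Ot.
have [i [b [a [a' [n [h [N [Nt Ni Nb e e']]]]]]]] := local_frac2 s s' Ot.
have v : N `<=` xpre O by move=> y /Nb/h.
exists i, b, (n + n)%N, h, N, Ni, v; split=> //.
rewrite (sharpE (a := a * a') (h := h) _ _ _ Nb); last first.
  by rewrite !rmorphM exprD mulrACA e e'.
by rewrite !rmorphM exprD mulrACA (sharpE e v Ni Nb) (sharpE e' v Ni Nb).
Qed.

Let sharp1 O : @sharp O 1 = 1.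
Proof.
apply: sharp_eq => t Ot.
have [i [b [a [n [h [N [Nt Ni Nb e]]]]]]] := local_frac (1 : rs_O O) Ot.
have v : N `<=` xpre O by move=> y /Nb/h.
exists i, b, 0%N, h, N, Ni, v; split=> //.
rewrite (sharpE (a := 1) (h := h) _ _ _ Nb); last by rewrite expr0 mulr1 !rmorph1.
by rewrite expr0 mulr1 !rmorph1.
Qed.

Let sharp_natural (O O' : opens P) (h : O' `<=` O) (k : xpre O' `<=` xpre O) (s : rs_O O) :
  sharp (rs_res h s) = rs_res k (sharp s).
Proof.
apply: sharp_eq => t Ot.
have [i [b [a [n [h' [N [Nt Ni Nb e]]]]]]] := local_frac (rs_res h s) Ot.
have v : N `<=` xpre O' by move=> y /Nb/h'.
have v' : N `<=` xpre O by move=> y /v/k.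
have l : opensD b `<=` O by move=> y /h'/h.
exists i, b, n, h', N, Ni, v; split=> //.
rewrite (sharpE e v Ni Nb) (rs_res_comp k v v').
rewrite (rs_res_comp h h' l) in e.
by rewrite (sharpE e v' Ni Nb).
Qed.

Let sharp_local (O : opens P) (s : rs_O O) t : oset O (x t) ->
  germ_unit (sharp s) t -> germ_unit s (x t).
Proof.
move=> Ot; have [i [b [a [n [h [N [Nt Ni Nb e]]]]]]] := local_frac s Ot.
have v : N `<=` xpre O by move=> y /Nb/h.
have Db := Nb _ Nt; have [_ bx] := Db.
have be : germ_unit (rs_res Ni (phi i b) ^+ n) t.
  by apply: germ_unitX; apply/germ_unit_res => //; apply/xE => //; exact: (Ni t).
move/(germ_unit_res v _ Nt) => H.
have : germ_unit (rs_res Ni (phi i a)) t.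
  by rewrite -(sharpE e v Ni Nb); apply/germ_unitM.
move/(germ_unit_res Ni _ Nt)/(xE _ (Ni _ Nt))/(germ_unit_res (@opensD_sub _ _ b) _ Db).
by rewrite -e => /germ_unitM[] /(germ_unit_res h _ Db).
Qed.

Lemma lrs_glue : exists g : LRSHom Q P, (forall i, W i `<=` g @^-1` A i) /\
  forall i (l : W i `<=` g @^-1` A i) r, pull l r = phi i r.
Proof.
pose sh O := rmorphism_of (@sharpD O) (@sharpM O) (@sharp1 O).
exists (@MkLRSHom Q P x x_cont sh sharp_natural sharp_local).
split=> [i t Wt|i l r]; first exact: xA.
(* Over [A i] itself, [r] is the fraction [r / 1 ^ 0] on [D(1)]. *)
have e : rs_res (@opensD_sub _ _ 1) r * rs_res (@opensD_sub _ _ 1) (1 : rs_O (A i)) ^+ 0 =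
    rs_res (@opensD_sub _ _ 1) r by rewrite expr0 mulr1.
have Nb : W i `<=` x @^-1` opensD (1 : rs_O (A i)).
  by move=> t Wt; split; [exact: xA|apply: germ_unit1; exact: xA].
have := sharpE e l (@subset_refl _ _) Nb.
by rewrite expr0 mulr1 rs_res_id.
Qed.

End GlueMorphism.

(** * Dual numbers *)

(* The pair [(a, b)] stands for [a + b ε] with [ε ^ 2 = 0]. *)
Definition dual (R : Type) : Type := (R * R)%type.

(** Only the additive structure is copied: the product [R * R] carries the componentwise
    multiplication, which is why [dual] is a name of its own. *)
HB.instance Definition _ (R : comPzRingType) := GRing.Zmodule.copy (dual R) (R * R)%type.

Section DualRing.
Variable R : comPzRingType.
Implicit Types u v w : dual R.

Definition dual_mul u v : dual R := (u.1 * v.1, u.1 * v.2 + u.2 * v.1).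

Lemma dual_mulA : associative dual_mul.
Proof. by move=> u v w; congr pair => /=; ring. Qed.
Lemma dual_mulC : commutative dual_mul.
Proof. by move=> u v; congr pair => /=; ring. Qed.
Lemma dual_mul1 : left_id ((1, 0) : dual R) dual_mul.
Proof. by move=> [a b]; congr pair => /=; ring. Qed.
Lemma dual_mulD : left_distributive dual_mul +%R.
Proof. by move=> u v w; congr pair => /=; ring. Qed.

HB.instance Definition _ :=
  GRing.Zmodule_isComPzRing.Build (dual R) dual_mulA dual_mulC dual_mul1 dual_mulD.

(** Binomial formula with [ε ^ 2 = 0]. For [n = 0] the truncated [n.-1] is harmless, since the term
    is taken [0] times. *)
Lemma dual_expr u n : u ^+ n = (u.1 ^+ n, (u.1 ^+ n.-1 * u.2) *+ n).
Proof.
elim: n => [|n IH]; first by rewrite expr0 mulr0n.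
rewrite exprS IH; congr pair; rewrite /= -?exprS //.
case: n IH => [|n] _ /=; first by rewrite mulr0n mulr0 add0r expr0 mul1r mulr1 mulr1n.
by rewrite mulrnAr mulrA -exprS [u.2 * _]mulrC [RHS]mulrSr.
Qed.

End DualRing.

Section DualMaps.
Variables (A R : comPzRingType) (beta : {rmorphism A -> R}) (D : A -> R).
Hypothesis DD : forall a b, D (a + b) = D a + D b.
Hypothesis DM : forall a b, D (a * b) = beta a * D b + beta b * D a.

Let f (a : A) : dual R := (beta a, D a).

Let f_add : {morph f : a b / a + b}.
Proof. by move=> a b; rewrite /f rmorphD DD. Qed.
Let f_mul : {morph f : a b / a * b}.
Proof. by move=> a b; congr pair; rewrite /= ?rmorphM // DM [D a * _]mulrC. Qed.
Let f_1 : f 1 = 1.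
Proof.
congr pair; rewrite ?rmorph1 //.
by have := DM 1 1; rewrite mul1r rmorph1 !mul1r => e; apply: (addrI (D 1)); rewrite addr0 -e.
Qed.

Definition dual_rmorphism : {rmorphism A -> dual R} := rmorphism_of f_add f_mul f_1.

Lemma dual_rmorphismE a : dual_rmorphism a = (beta a, D a).
Proof. by []. Qed.

End DualMaps.

Section DualRestriction.
Variables (R R' : comPzRingType) (f : {rmorphism R -> R'}).

Let m (u : dual R) : dual R' := (f u.1, f u.2).
Let m_add : {morph m : u v / u + v}.
Proof. by move=> u v; congr pair; rewrite rmorphD. Qed.
Let m_mul : {morph m : u v / u * v}.
Proof. by move=> u v; congr pair; rewrite ?rmorphD !rmorphM. Qed.
Let m_1 : m 1 = 1.
Proof. by congr pair; rewrite ?rmorph1 ?rmorph0. Qed.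

Definition dual_map : {rmorphism dual R -> dual R'} := rmorphism_of m_add m_mul m_1.

Lemma dual_mapE u : dual_map u = (f u.1, f u.2).
Proof. by []. Qed.

End DualRestriction.

(** * The trivial square-zero thickening of a scheme *)

Section DualRingedSpace.
Variable X : RingedSpace.

Program Definition dual_rs : RingedSpace :=
  @MkRingedSpace (rs_space X) (fun U => (dual (rs_O U) : comPzRingType))
    (fun U V h => dual_map (rs_res h)) _ _ _ _.
Next Obligation. by move=> U h [a b]; rewrite dual_mapE /= !rs_res_id. Qed.
Next Obligation. by move=> U V W h k l [a b]; rewrite !dual_mapE /= !(rs_res_comp h k l). Qed.
Next Obligation.
move=> I U V h cov [a b] [a' b'] H; congr pair; apply: (rs_separated (h := h)) => // i.
  by move: (H i); rewrite !dual_mapE => -[].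
by move: (H i); rewrite !dual_mapE => -[].
Qed.
Next Obligation.
move=> I U V h cov s H.
have [|a Ha] := @rs_glue X I U V h cov (fun i => (s i).1).
  by move=> i j; by move: (H i j); rewrite !dual_mapE => -[].
have [|b Hb] := @rs_glue X I U V h cov (fun i => (s i).2).
  by move=> i j; by move: (H i j); rewrite !dual_mapE => -[].
by exists (a, b) => i; rewrite dual_mapE /= Ha Hb; case: (s i).
Qed.

(** The inverse of [a + b ε] is [1 / a - (b / a ^ 2) ε]. Hence unit germs, and with them basic opens
    and the locality of stalks, depend on the first component alone. *)
Lemma dual_unitP (R : comPzRingType) (u : dual R) :
  (exists v, u * v = 1) <-> exists t, u.1 * t = 1.
Proof.
split=> [[v e]|[t e]]; first by exists v.1; move/(congr1 (@fst _ _)): e.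
exists (t, - (t * t * u.2)); congr pair => //=.
by rewrite mulrN !mulrA e mul1r; ring.
Qed.

Lemma dual_germ_unit (U : set X) (s : rs_O (r := dual_rs) U) x :
  germ_unit (X := dual_rs) s x <-> germ_unit (s.1 : rs_O (r := X) U) x.
Proof.
split=> [[V [h [Vx H]]]|[V [h [Vx H]]]]; exists V, h; split=> //.
  exact/(dual_unitP (rs_res h s)).
exact/(dual_unitP (rs_res (r := dual_rs) h s)).
Qed.

End DualRingedSpace.

Program Definition dual_lrs (X : LRS) : LRS := @MkLRS (dual_rs X) _ _.
Next Obligation. by move=> X x U Ux -[]; exact: lrs_nonzero Ux. Qed.
Next Obligation.
move=> X x U s Ux; rewrite !dual_germ_unit; exact: (@lrs_local X x U s.1 Ux).
Qed.

Section DualAffine.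
Variables (X : LRS) (U : opens X).

Lemma dual_basic_open (b : rs_O (r := dual_lrs X) U) :
  basic_open (X := dual_lrs X) b = basic_open (X := X) (b.1 : rs_O U).
Proof. by apply/seteqP; split=> x [Ux /dual_germ_unit]. Qed.

Lemma dual_affine : is_affine U -> is_affine (X := dual_lrs X) U.
Proof.
move=> aU; split.
- move=> x y Ux Uy e; apply: (affine_pointE aU) => // b.
  by have := (@point_primeE (dual_lrs X) U x y e (b, 0)); rewrite !dual_germ_unit.
- move=> I [I0 ID IM I1 Ip].
  pose J : set (rs_O (r := X) U) := [set a | I (a, 0)].
  have JE (u : rs_O (r := dual_lrs X) U) : I u <-> J u.1.
    (* Every [b ε] squares to zero and so lies in each prime; a prime is thus determined by its
       elements without [ε]-part. *)
    have eps b : I (0, b).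
      pose v : rs_O (r := dual_lrs X) U := (0, b).
      have e : v * v = 0 by congr pair; rewrite /= ?mulr0 ?mul0r ?addr0.
      by have := I0; rewrite -e => /Ip[].
    split=> H; rewrite /J /=.
      have := ID _ _ H (eps (- u.2)); congr (I _).
      by congr pair; rewrite /= ?addr0 ?subrr.
    have := ID _ _ H (eps u.2); congr (I _).
    by case: u {H} => a b; congr pair; rewrite /= ?addr0 ?add0r.
  have [|x Ux ex] := affine_surj aU (I := J).
    split; rewrite /J //=.
    + by move=> a b Ha Hb; have := ID _ _ Ha Hb; congr (I _); congr pair; rewrite /= addr0.
    + move=> a b Hb; have := IM (a, 0) _ Hb; congr (I _).
      by congr pair; rewrite /= ?mulr0 ?mul0r ?addr0.
    + move=> a b H; apply: Ip; move: H; congr (I _).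
      by congr pair; rewrite /= ?mulr0 ?mul0r ?addr0.
  exists x => //; apply/seteqP; split=> u; rewrite JE -ex /point_prime /= dual_germ_unit //.
- move=> V x Ux Vx; have [b Db bV] := affine_basis aU Ux Vx.
  exists ((b, 0) : rs_O (r := dual_lrs X) U); rewrite dual_basic_open //.
- move=> b; set h := @basic_open_sub _ _ _.
  have [t e] := affine_unit_on aU h (dual_basic_open b).
  by apply/dual_unitP; exists t.
- move=> b t; set h := @basic_open_sub _ _ _.
  have [a1 [n1 e1]] := affine_frac_on aU h (dual_basic_open b) t.1.
  have [a2 [n2 e2]] := affine_frac_on aU h (dual_basic_open b) t.2.
  (* The power [n] clears the denominators of both components. The [ε]-part of a power has one
     factor [b.1] less, which the exponent [n.+1] makes up for. *)
  pose n := (n1 + n2)%N.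
  exists (a1 * b.1 ^+ n2 * b.1, a2 * b.1 ^+ n1 * b.1 + (a1 * b.1 ^+ n2 * b.2) *+ n.+1), n.+1.
  rewrite dual_expr; congr pair; rewrite /=.
    by rewrite !rmorphM rmorphXn /= -e1 /n exprS exprD; ring.
  rewrite rmorphD rmorphMn !rmorphM !rmorphXn /= -e1 -e2 /n exprS exprD mulrnAr.
  by rewrite addrC; congr (_ + _); [|congr (_ *+ _)]; ring.
- move=> b a; set h := @basic_open_sub _ _ _ => e0.
  have [n1 e1] := affine_kernel_on aU (h := h) (a := a.1) (dual_basic_open b) (congr1 fst e0).
  have [n2 e2] := affine_kernel_on aU (h := h) (a := a.2) (dual_basic_open b) (congr1 snd e0).
  (* The exponent is one more than [n1 + n2] because the [ε]-part of the power contains one factor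
     [b.1] less. *)
  exists (n1 + n2).+1; rewrite dual_expr; congr pair; rewrite /=.
    by rewrite exprS addnC exprD -!mulrA e1 !mulr0.
  rewrite mulrnAl exprS exprD.
  have -> : b.1 * (b.1 ^+ n1 * b.1 ^+ n2) * a.2 = b.1 * b.1 ^+ n1 * (b.1 ^+ n2 * a.2) by ring.
  have -> : b.1 ^+ n1 * b.1 ^+ n2 * b.2 * a.1 = b.2 * b.1 ^+ n2 * (b.1 ^+ n1 * a.1) by ring.
  by rewrite e1 e2 !mulr0 mul0rn addr0.
Qed.

End DualAffine.

Program Definition dual_sch (X : Scheme) : Scheme := @MkScheme (dual_lrs X) _.
Next Obligation.
move=> X x; have [U aU Ux] := sch_cover x; exists U => //; exact: dual_affine.
Qed.

(** * Morphisms into tangent bundles *)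

Section SymOmega.
Variables (A B E : comPzRingType) (phi : {rmorphism A -> B}).
Variables (iota : {rmorphism B -> E}) (d : B -> E).
Hypothesis symE : is_sym_omega phi iota d.

(** Uniqueness in the universal property, applied to the derivation [h ∘ d] over [h ∘ iota]. *)
Lemma sym_rmorphism_eq (R : comPzRingType) (h h' : {rmorphism E -> R}) :
  (forall b, h (iota b) = h' (iota b)) -> (forall b, h (d b) = h' (d b)) -> h =1 h'.
Proof.
move=> e1 e2; have [[dD dM dS] univ] := symE.
have [|u [_ uu]] := univ R (h \o iota)%FUN (h \o d)%FUN.
  split=> [b b'|b b'|a] /=; first by rewrite dD rmorphD.
    by rewrite dM rmorphD !rmorphM.
  by rewrite dS rmorph0.
have <- : u = h by apply: uu; split.
have <- : u = h' by apply: uu; split=> b /=; rewrite ?e1 ?e2.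
by [].
Qed.

(* A derivation is a ring map to the dual numbers. *)
Lemma sym_derivation_eq (R : comPzRingType) (beta : {rmorphism E -> R}) (D D' : E -> R) :
  (forall a b, D (a + b) = D a + D b) ->
  (forall a b, D (a * b) = beta a * D b + beta b * D a) ->
  (forall a b, D' (a + b) = D' a + D' b) ->
  (forall a b, D' (a * b) = beta a * D' b + beta b * D' a) ->
  (forall b, D (iota b) = D' (iota b)) -> (forall b, D (d b) = D' (d b)) -> D =1 D'.
Proof.
move=> DD DM DD' DM' e1 e2 x.
have := @sym_rmorphism_eq _ (dual_rmorphism DD DM) (dual_rmorphism DD' DM').
move=> H; have : dual_rmorphism DD DM x = dual_rmorphism DD' DM' x.
  by apply: H => b; rewrite !dual_rmorphismE ?e1 ?e2.
exact: (congr1 (fun u : dual R => u.2)).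
Qed.

End SymOmega.

Lemma pull_sharp (X Y Z : LRS) (g : LRSHom Y Z) (f : LRSHom X Y) (U : opens Z)
  (W : opens X) (h : W `<=` f @^-1` preim g U) (k : W `<=` lrs_comp g f @^-1` U) s :
  pull h (lh_sharp g U s) = pull k s.
Proof. by rewrite (Prop_irrelevance k h). Qed.

Lemma sharp_pull (X Y Z : LRS) (g : LRSHom Y Z) (f : LRSHom X Y) (U : opens Z)
  (V : opens Y) (h : V `<=` g @^-1` U) (k : preim f V `<=` lrs_comp g f @^-1` U) s :
  lh_sharp f V (pull h s) = pull k s.
Proof.
have l : preim f V `<=` f @^-1` V by [].
by rewrite (pull_comp k l h) /pull /= rs_res_id.
Qed.

Lemma exists_piece (S : Scheme) (Z : SchOver S) (O : opens (usch Z)) (O' : opens S) z :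
  oset O z -> oset O' (ustr Z z) ->
  exists V U, [/\ affine_piece (Z := Z) V U, oset U z, U `<=` O & V `<=` O'].
Proof.
move=> Oz Oz'; have [V [aV Vz VO]] := affine_basis_scheme Oz'.
have [|U [aU Uz UO]] := @affine_basis_scheme (usch Z) (opensI O (preim (ustr Z) V)) z.
  by [].
exists V, U; split=> //; last by move=> y /UO[].
by split=> // y /UO[].
Qed.

Section ZariskiTangent.
Variables (S : Scheme) (TS : ZariskiTangentStructure S).
Implicit Types Z : SchOver S.

Lemma piece_inv Z V (U : opens (usch Z)) :
  affine_piece V U -> affine_piece (Z := TS Z) V (zt_inv TS U).
Proof.
move=> h; split; [exact: piece_base h|exact (zt_affine TS h)|move=> t Ut].
have <- : lrs_comp (ustr Z) (zt_p TS Z) = ustr (TS Z) by exact: (proj2_sig (tp TS Z)).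
exact: piece_sub h _ Ut.
Qed.

(** This is functoriality of [T] at the identity of [Z], read from the piece [U'] to the larger
    piece [U]. *)
Lemma zt_d_res Z V (U : opens (usch Z)) V' (U' : opens (usch Z)) (k : U' `<=` U)
  (l : zt_inv TS U' `<=` zt_inv TS U) b :
  affine_piece V U -> affine_piece V' U' ->
  rs_res l (zt_d TS b) = zt_d TS (rs_res k b).
Proof.
move=> h h'.
have e : umap (fm TS (idm Z)) = lrs_id (usch (TS Z)) by rewrite fm_id.
have l' : zt_inv TS U' `<=` umap (fm TS (idm Z)) @^-1` zt_inv TS U by rewrite e.
have [_] := zt_map (g := idm Z) h' h k l' b.
rewrite (pull_id k b) => <-.
by rewrite -(pull_id (l : _ `<=` lrs_id _ @^-1` _)); apply: pull_eq.
Qed.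

Lemma zt_p_res Z (U U' : opens (usch Z)) (k : U' `<=` U)
  (l : zt_inv TS U' `<=` zt_inv TS U) b :
  rs_res l (lh_sharp (zt_p TS Z) U b : rs_O (zt_inv TS U)) = lh_sharp (zt_p TS Z) U' (rs_res k b).
Proof. by rewrite (lh_natural k l). Qed.

Lemma zt_der Z V (U : opens (usch Z)) (h : affine_piece V U) :
  is_derivation (R := rs_O (zt_inv TS U)) (pull (piece_sub h))
    (lh_sharp (zt_p TS Z) U) (zt_d TS (U := U)).
Proof. by have [] := zt_sym TS h. Qed.

Lemma tangent_hom_eq (Q : LRS) Z (g h : LRSHom Q (usch (TS Z))) :
  (forall t : Q, exists V (U : opens (usch Z)) (N : opens Q)
    (l : N `<=` g @^-1` zt_inv TS U) (l' : N `<=` h @^-1` zt_inv TS U),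
    [/\ affine_piece V U, oset N t & forall b,
      pull l (lh_sharp (zt_p TS Z) U b) = pull l' (lh_sharp (zt_p TS Z) U b) /\
      pull l (zt_d TS b) = pull l' (zt_d TS b)]) -> g = h.
Proof.
move=> H; apply: lrs_hom_eq => t; have [V [U [N [l [l' [p Nt e]]]]]] := H t.
exists (zt_inv TS U), N, l, l'; split=> //; first exact (zt_affine TS p).
apply: (sym_rmorphism_eq (zt_sym TS p) (h := pull l) (h' := pull l')) => b;
  by have [] := e b.
Qed.

(** The four symbols suffice because [zt_inv TS U] is itself the ring of an affine piece: [b] and
    [db] determine the ring map on its sections, and [δ], a derivation along that map, is then
    determined by its values on [b] and [db]. *)
Lemma tangent2_hom_eq (Q : LRS) Z (g h : LRSHom Q (usch (TS (TS Z)))) :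
  (forall t : Q, exists V (U : opens (usch Z)) (N : opens Q)
    (l : N `<=` g @^-1` zt_inv TS (zt_inv TS U)) (l' : N `<=` h @^-1` zt_inv TS (zt_inv TS U)),
    [/\ affine_piece V U, oset N t & forall b,
      [/\ pull l (lh_sharp (zt_p TS (TS Z)) (zt_inv TS U) (lh_sharp (zt_p TS Z) U b)) =
          pull l' (lh_sharp (zt_p TS (TS Z)) (zt_inv TS U) (lh_sharp (zt_p TS Z) U b)),
      pull l (lh_sharp (zt_p TS (TS Z)) (zt_inv TS U) (zt_d TS b)) =
        pull l' (lh_sharp (zt_p TS (TS Z)) (zt_inv TS U) (zt_d TS b)),
      pull l (zt_d TS (U := zt_inv TS U) (lh_sharp (zt_p TS Z) U b)) =
        pull l' (zt_d TS (U := zt_inv TS U) (lh_sharp (zt_p TS Z) U b)) &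
      pull l (zt_d TS (zt_d TS b)) = pull l' (zt_d TS (zt_d TS b))]]) -> g = h.
Proof.
move=> H; apply: tangent_hom_eq => t; have [V [U [N [l [l' [p Nt e]]]]]] := H t.
exists V, (zt_inv TS U), N, l, l'; split=> //; first exact: piece_inv.
have e1 x : pull l (lh_sharp (zt_p TS (TS Z)) (zt_inv TS U) x) =
    pull l' (lh_sharp (zt_p TS (TS Z)) (zt_inv TS U) x).
  apply: (sym_rmorphism_eq (zt_sym TS p)
    (h := (pull l \o lh_sharp (zt_p TS (TS Z)) (zt_inv TS U))%FUN)
    (h' := (pull l' \o lh_sharp (zt_p TS (TS Z)) (zt_inv TS U))%FUN)) => b /=;
    by have [] := e b.
move=> x; split; first exact: e1.
have [dD dM _] := zt_der (piece_inv p).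
pose beta := (pull l \o lh_sharp (zt_p TS (TS Z)) (zt_inv TS U))%FUN : {rmorphism _ -> _}.
have bE y : beta y = pull l (lh_sharp (zt_p TS (TS Z)) (zt_inv TS U) y) by [].
move: x; apply: (sym_derivation_eq (zt_sym TS p) (beta := beta)) => [a b|a b|a b|a b|b|b].
- by rewrite dD rmorphD.
- by rewrite dM rmorphD !rmorphM.
- by rewrite dD rmorphD.
- by rewrite dM rmorphD !rmorphM !bE !e1.
- by have [] := e b.
- by have [] := e b.
Qed.

End ZariskiTangent.

(** * Tangent maps over a change of base *)

Section TangentMap.
Variables (X Y : Scheme) (TX : ZariskiTangentStructure X) (TY : ZariskiTangentStructure Y).

(* [G : T_{P/X} -> T_{Z/Y}] is the differential of [g : P -> Z]; the base schemes
   may differ. *)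
Record is_tangent_map (P : SchOver X) (Z : SchOver Y) (g : LRSHom (usch P) (usch Z))
    (G : LRSHom (usch (TX P)) (usch (TY Z))) : Prop := {
  tmap_base : lrs_comp (zt_p TY Z) G = lrs_comp g (zt_p TX P);
  tmap_d : forall V U V' U' (h : affine_piece (Z := P) V U) (h' : affine_piece (Z := Z) V' U')
    (k : U `<=` g @^-1` U') (l : zt_inv TX U `<=` G @^-1` zt_inv TY U') b,
    pull l (zt_d TY b) = zt_d TX (pull k b) }.

Variables (P : SchOver X) (Z : SchOver Y) (g : LRSHom (usch P) (usch Z)).

Lemma tmap_sub (G : LRSHom (usch (TX P)) (usch (TY Z))) (U : opens (usch P)) (U' : opens (usch Z)) :
  lrs_comp (zt_p TY Z) G = lrs_comp g (zt_p TX P) ->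
  U `<=` g @^-1` U' -> zt_inv TX U `<=` G @^-1` zt_inv TY U'.
Proof.
move=> e k t Ut; have : oset U' (lrs_comp (zt_p TY Z) G t) by rewrite e; exact: (k _ Ut).
by [].
Qed.

Lemma tmap_sharp G (e : lrs_comp (zt_p TY Z) G = lrs_comp g (zt_p TX P))
  (U : opens (usch P)) (U' : opens (usch Z)) (k : U `<=` g @^-1` U')
  (l : zt_inv TX U `<=` G @^-1` zt_inv TY U') b :
  pull l (lh_sharp (zt_p TY Z) U' b) = lh_sharp (zt_p TX P) U (pull k b).
Proof.
have k' : preim (zt_p TX P) U `<=` lrs_comp g (zt_p TX P) @^-1` U' by move=> t /k.
have l' : zt_inv TX U `<=` lrs_comp (zt_p TY Z) G @^-1` U' by move=> t /l.
rewrite (sharp_pull k k') (pull_sharp l l'); exact: pull_eq.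
Qed.

(** The definition quantifies over all pairs of pieces, whereas constructions yield the formula on
    small convenient pairs. As [d] commutes with restriction, one such pair around each point is
    enough. *)
Lemma tmap_local G : lrs_comp (zt_p TY Z) G = lrs_comp g (zt_p TX P) ->
  (forall (t : usch P) V U V' U', affine_piece (Z := P) V U -> affine_piece (Z := Z) V' U' ->
     U `<=` g @^-1` U' -> oset U t -> exists V1 (U1 : opens (usch P)) V1' (U1' : opens (usch Z))
     (k1 : U1 `<=` g @^-1` U1') (l1 : zt_inv TX U1 `<=` G @^-1` zt_inv TY U1'),
     [/\ affine_piece (Z := P) V1 U1 /\ affine_piece (Z := Z) V1' U1',
         oset U1 t, U1 `<=` U, U1' `<=` U' &
         forall b, pull l1 (zt_d TY b) = zt_d TX (pull k1 b)]) ->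
  is_tangent_map g G.
Proof.
move=> e H; split=> // V U V' U' h h' k l b.
apply: eq_sections => s Us.
have [V1 [U1 [V1' [U1' [k1 [l1 [[h1 h1'] U1s UU UU' E]]]]]]] := H _ _ _ _ _ h h' k Us.
have i : zt_inv TX U1 `<=` zt_inv TX U by move=> t /UU.
have i' : zt_inv TY U1' `<=` zt_inv TY U' by move=> t /UU'.
exists (zt_inv TX U1), i; split=> //.
have l2 : zt_inv TX U1 `<=` G @^-1` zt_inv TY U' by move=> t /i/l.
have k2 : U1 `<=` g @^-1` U' by move=> t /UU/k.
rewrite (res_pull l i l2) -(pull_res l1 i' l2) (zt_d_res UU' i' b h' h1') E.
by rewrite (pull_res k1 UU' k2) (zt_d_res UU i _ h h1) (res_pull k UU k2).
Qed.

Lemma exists_piece_map (O : opens (usch P)) (O' : opens (usch Z)) z :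
  oset O z -> oset O' (g z) -> exists V U V' U',
    [/\ affine_piece (Z := P) V U, affine_piece (Z := Z) V' U', oset U z,
        U `<=` g @^-1` U' & U `<=` O /\ U' `<=` O'].
Proof.
move=> Oz Oz'.
have [V' [U' [h' Uz' UO' _]]] := @exists_piece Y Z O' (Opens openT) (g z) Oz' I.
have [//|//|V [U [h Uz UO _]]] := @exists_piece X P (opensI O (preim g U')) (Opens openT) z.
by exists V, U, V', U'; split=> //; [move=> y /UO[]|split=> // y /UO[]].
Qed.

Lemma tmap_uniq G G' : is_tangent_map g G -> is_tangent_map g G' -> G = G'.
Proof.
move=> H H'; apply: tangent_hom_eq => t.
have [V [U [V' [U' [h h' Ut k _]]]]] :=
  @exists_piece_map (Opens openT) (Opens openT) (zt_p TX P t) I I.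
have l := tmap_sub (tmap_base H) k; have l' := tmap_sub (tmap_base H') k.
exists V', U', (zt_inv TX U), l, l'; split=> // b.
rewrite (tmap_sharp (tmap_base H) k l) (tmap_sharp (tmap_base H') k l').
by rewrite (tmap_d H h h' k l) (tmap_d H' h h' k l').
Qed.

(** * Existence of the differential *)

Section Existence.
Variable f : LRSHom X Y.
Hypothesis gf : lrs_comp (ustr Z) g = lrs_comp f (ustr P).

(** The bases are required to be compatible as well: [pm_f] makes functions of [pm_V'] into
    functions of [pm_V], which [d] kills. *)
Record piece_map := PieceMap {
  pm_V : opens X; pm_U : opens (usch P); pm_V' : opens Y; pm_U' : opens (usch Z);
  pm_h : affine_piece (Z := P) pm_V pm_U;
  pm_h' : affine_piece (Z := Z) pm_V' pm_U';
  pm_k : pm_U `<=` g @^-1` pm_U';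
  pm_f : pm_V `<=` f @^-1` pm_V' }.

Lemma exists_piece_map_over (O : opens (usch P)) (O' : opens (usch Z)) z :
  oset O z -> oset O' (g z) -> exists i : piece_map,
    [/\ oset (pm_U i) z, pm_U i `<=` O & pm_U' i `<=` O'].
Proof.
move=> Oz Oz'.
have [V' [U' [h' Uz' UO' _]]] := @exists_piece Y Z O' (Opens openT) (g z) Oz' I.
have fz : oset V' (f (ustr P z)).
  have -> : f (ustr P z) = ustr Z (g z) by have := congr1 (fun q => lh_fun q z) gf.
  exact: (piece_sub h' Uz').
have [//|//|V [U [h Uz UO VO]]] :=
  @exists_piece X P (opensI O (preim g U')) (preim f V') z.
have k : U `<=` g @^-1` U' by move=> y /UO[].
by exists (PieceMap h h' k VO); split=> // y /UO[].
Qed.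

Lemma piece_map_der i : is_derivation (R := rs_O (zt_inv TX (pm_U i))) (pull (piece_sub (pm_h' i)))
  (lh_sharp (zt_p TX P) (pm_U i) \o pull (@pm_k i))%FUN
  (fun b => zt_d TX (pull (@pm_k i) b)).
Proof.
have [dD dM dS] := zt_der TX (pm_h i).
split=> [b b'|b b'|c]; [by rewrite rmorphD dD|by rewrite rmorphM dM|].
rewrite -[RHS](dS (pull (@pm_f i) c)); congr zt_d.
have l : pm_U i `<=` lrs_comp (ustr Z) g @^-1` pm_V' i by move=> t /pm_k/(piece_sub (pm_h' i)).
have l' : pm_U i `<=` lrs_comp f (ustr P) @^-1` pm_V' i by move=> t /(piece_sub (pm_h i))/pm_f.
rewrite -(pull_comp l (@pm_k i) (piece_sub (pm_h' i))).
by rewrite -(pull_comp l' (piece_sub (pm_h i)) (@pm_f i)); exact: pull_eq.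
Qed.

Let phi_ex i : exists phi : {rmorphism rs_O (zt_inv TY (pm_U' i)) -> rs_O (zt_inv TX (pm_U i))},
  (forall b, phi (lh_sharp (zt_p TY Z) (pm_U' i) b) =
             lh_sharp (zt_p TX P) (pm_U i) (pull (@pm_k i) b)) /\
  (forall b, phi (zt_d TY b) = zt_d TX (pull (@pm_k i) b)).
Proof.
have [_ univ] := zt_sym TY (pm_h' i).
by have [phi [H _]] := univ _ _ _ (piece_map_der i); exists phi.
Qed.

(** The universal property of [Sym] gives a ring map on each [piece_map]. Compatibility with a
    smaller [piece_map] is checked on generators, and common refinements exist around each point, so
    these ring maps glue. *)
Lemma tmap_ex : exists G, is_tangent_map g G.
Proof.
pose A i := zt_inv TY (pm_U' i); pose W i := zt_inv TX (pm_U i).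
pose phi i := sval (cid (phi_ex i)).
have phi_p i b : phi i (lh_sharp (zt_p TY Z) (pm_U' i) b) =
    lh_sharp (zt_p TX P) (pm_U i) (pull (@pm_k i) b).
  by have [-> _] := svalP (cid (phi_ex i)).
have phi_d i b : phi i (zt_d TY b) = zt_d TX (pull (@pm_k i) b).
  by have [_ ->] := svalP (cid (phi_ex i)).
have sub i k (u : pm_U k `<=` pm_U i) : pm_U k `<=` g @^-1` pm_U' i.
  by move=> t /u/pm_k.
have compat i k (u : pm_U k `<=` pm_U i) (u' : pm_U' k `<=` pm_U' i) 
    (a : zt_inv TY (pm_U' k) `<=` zt_inv TY (pm_U' i))
    (w : zt_inv TX (pm_U k) `<=` zt_inv TX (pm_U i)) r : phi k (rs_res a r) = rs_res w (phi i r).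
  move: r; apply: (sym_rmorphism_eq (zt_sym TY (pm_h' i))
    (h := (phi k \o rs_res a)%FUN) (h' := (rs_res w \o phi i)%FUN)) => b; rewrite /comp.
    transitivity (phi k (lh_sharp (zt_p TY Z) (pm_U' k) (rs_res u' b))).
      by congr (phi k _); exact: zt_p_res.
    transitivity (rs_res w (lh_sharp (zt_p TX P) (pm_U i) (pull (@pm_k i) b) : rs_O (zt_inv TX (pm_U i)))).
      rewrite phi_p zt_p_res.

      by congr (lh_sharp _ _ _); rewrite (res_pull _ u (sub i k u)) (pull_res _ u' (sub i k u)).
    by congr (rs_res w _); rewrite -phi_p.
  transitivity (phi k (zt_d TY (rs_res u' b))).
    by congr (phi k _); exact: zt_d_res (pm_h' i) (pm_h' k).
  transitivity (rs_res w (zt_d TX (pull (@pm_k i) b))); last first.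
    by congr (rs_res w _); rewrite -phi_d.
  rewrite phi_d (zt_d_res u w _ (pm_h i) (pm_h k)).
  by congr zt_d; rewrite (res_pull _ u (sub i k u)) (pull_res _ u' (sub i k u)).
have [i|t|i j t Wi Wj|G [GA GE]] := @lrs_glue (usch (TX P)) (usch (TY Z)) piece_map A W phi.
- exact (zt_affine TY (pm_h' i)).
- have [i [Ui _ _]] := @exists_piece_map_over (Opens openT) (Opens openT) (zt_p TX P t) I I.
  by exists i.
- have [k [Uk Uij Uij']] := @exists_piece_map_over (opensI (pm_U i) (pm_U j))
    (opensI (pm_U' i) (pm_U' j)) (zt_p TX P t) (conj Wi Wj) (conj (@pm_k i _ Wi) (@pm_k j _ Wj)).
  have ui : pm_U k `<=` pm_U i by move=> y /Uij[].
  have uj : pm_U k `<=` pm_U j by move=> y /Uij[].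
  have ui' : pm_U' k `<=` pm_U' i by move=> y /Uij'[].
  have uj' : pm_U' k `<=` pm_U' j by move=> y /Uij'[].
  have ai : A k `<=` A i by move=> y /ui'.
  have aj : A k `<=` A j by move=> y /uj'.
  have wi : W k `<=` W i by move=> y /ui.
  have wj : W k `<=` W j by move=> y /uj.
  by exists k, ai, aj, wi, wj; split=> // r; exact: compat.
exists G; apply: tmap_local.
  apply: lrs_hom_eq => t.
  have [i [Ui _ _]] := @exists_piece_map_over (Opens openT) (Opens openT) (zt_p TX P t) I I.
  have l : W i `<=` lrs_comp (zt_p TY Z) G @^-1` pm_U' i by move=> y /GA.
  have l' : W i `<=` lrs_comp g (zt_p TX P) @^-1` pm_U' i by move=> y /pm_k.
  exists (pm_U' i), (W i), l, l'; split=> //; first exact: piece_total (pm_h' i).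
  move=> b; rewrite -(pull_sharp (GA i) l) GE phi_p; exact: sharp_pull.
move=> t V U V' U' h h' k Ut.
have [i [Ui UU UU']] := exists_piece_map_over Ut (k _ Ut).
exists (pm_V i), (pm_U i), (pm_V' i), (pm_U' i), (@pm_k i), (GA i); split=> //.
- by split; [exact: pm_h|exact: pm_h'].
- by move=> b; rewrite GE phi_d.
Qed.

End Existence.
End TangentMap.

Arguments is_tangent_map {X Y} TX TY {P Z} g G.

Lemma tmap_fm (S : Scheme) (TS : ZariskiTangentStructure S) (P P' : SchOver S) (h : hom P P') :
  is_tangent_map TS TS (umap h) (umap (fm TS h)).
Proof.
split=> [|V U V' U' p p' k l b]; first exact (congr1 (@umap S _ _) (tp_nat TS h)).
by have [] := zt_map p p' k l b.
Qed.

(** A map from a piece of [P] to a piece of [K] need not factor through one affine piece of [Z];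
    such a piece is inserted locally. *)
Lemma tmap_comp (X Y W : Scheme) (TX : ZariskiTangentStructure X)
  (TY : ZariskiTangentStructure Y) (TW : ZariskiTangentStructure W)
  (P : SchOver X) (Z : SchOver Y) (K : SchOver W)
  (g : LRSHom (usch P) (usch Z)) (g' : LRSHom (usch Z) (usch K)) G G' :
  is_tangent_map TX TY g G -> is_tangent_map TY TW g' G' ->
  is_tangent_map TX TW (lrs_comp g' g) (lrs_comp G' G).
Proof.
move=> H H'; have e : lrs_comp (zt_p TW K) (lrs_comp G' G) = lrs_comp (lrs_comp g' g) (zt_p TX P).
  by rewrite lrs_comp_assoc (tmap_base H') -!lrs_comp_assoc (tmap_base H).
apply: tmap_local => // t V U V' U' h h' k Ut.
have [V1 [U1 [V2 [U2 [h1 h2 U1t k12 [U1U U2U]]]]]] :=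
  @exists_piece_map X Y P Z g U (preim g' U') t Ut (k _ Ut).
have k1 : U1 `<=` lrs_comp g' g @^-1` U' by move=> y /U1U/k.
have k2 : U2 `<=` g' @^-1` U' by [].
have l1 := tmap_sub e k1.
exists V1, U1, V', U', k1, l1; split=> // b.
rewrite (pull_comp l1 (tmap_sub (tmap_base H) k12) (tmap_sub (tmap_base H') k2)).
by rewrite (tmap_d H' h2 h' k2) (tmap_d H h1 h2 k12) -(pull_comp k1 k12 k2).
Qed.

(** * Differentials commute with the structure maps *)

Section TangentMapNaturality.
Variables (X Y : Scheme) (TX : ZariskiTangentStructure X) (TY : ZariskiTangentStructure Y).
Variables (P : SchOver X) (Z : SchOver Y) (g : LRSHom (usch P) (usch Z)).
Variable G : LRSHom (usch (TX P)) (usch (TY Z)).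
Hypothesis gG : is_tangent_map TX TY g G.

Lemma section_sub (S : Scheme) (TS : ZariskiTangentStructure S) (K : SchOver S) (U : opens (usch K)) :
  U `<=` umap (t0 TS K) @^-1` zt_inv TS U.
Proof.
move=> t Ut; have : oset U (umap (tp TS K ∘ t0 TS K) t) by rewrite tp_t0.
by [].
Qed.

Lemma tmap_0 : lrs_comp G (umap (t0 TX P)) = lrs_comp (umap (t0 TY Z)) g.
Proof.
apply: tangent_hom_eq => t.
have [V [U [V' [U' [h h' Ut k _]]]]] :=
  @exists_piece_map X Y P Z g (Opens openT) (Opens openT) t I I.
have l0 := @section_sub X TX P U; have l0' := @section_sub Y TY Z U'.
have lG := tmap_sub (tmap_base gG) k.
have l : U `<=` lrs_comp G (umap (t0 TX P)) @^-1` zt_inv TY U' by move=> y /l0/lG.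
have l' : U `<=` lrs_comp (umap (t0 TY Z)) g @^-1` zt_inv TY U' by move=> y /k/l0'.
exists V', U', U, l, l'; split=> // b.
rewrite !(pull_comp l l0 lG) !(pull_comp l' k l0').
rewrite (tmap_sharp (tmap_base gG) k) (tmap_d gG h h' k).
have [-> ->] := zt_zero h (@subset_refl _ _) l0 (pull k b).
have [-> ->] := zt_zero h' (@subset_refl _ _) l0' b.
by rewrite !rs_res_id rmorph0.
Qed.

(** The map of second pullback powers induced by [G] is not built; a common source [Q] with related
    projections replaces it. In the theorem [u] is [α_2] and [v] is the projection from the base
    change of [T_2]. *)
Lemma tmap_add (Q : LRS) (u : LRSHom Q (usch (tpow TX 2 P))) (v : LRSHom Q (usch (tpow TY 2 Z))) :
  lrs_comp (umap (tproj TY Z ord0)) v = lrs_comp G (lrs_comp (umap (tproj TX P ord0)) u) ->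
  lrs_comp (umap (tproj TY Z ord_max)) v = lrs_comp G (lrs_comp (umap (tproj TX P ord_max)) u) ->
  lrs_comp (umap (tadd TY Z)) v = lrs_comp G (lrs_comp (umap (tadd TX P)) u).
Proof.
move=> e1 e2; apply: tangent_hom_eq => t.
have [V [U [V' [U' [h h' Ut k _]]]]] :=
  @exists_piece_map X Y P Z g (Opens openT) (Opens openT) (umap (tbase TX 2 P) (u t)) I I.
have lG := tmap_sub (tmap_base gG) k.
pose M := preim (umap (tbase TX 2 P)) U.
pose M' := preim (umap (tbase TY 2 Z)) U'.
pose N := preim u M.
have sub (S : Scheme) (TS : ZariskiTangentStructure S) (K : SchOver S) (O : opens (usch K)) a :
    tp TS K ∘ a = tbase TS 2 K -> preim (umap (tbase TS 2 K)) O `<=` umap a @^-1` zt_inv TS O.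
  by move=> <-.
have [[bX _] [bY _]] := (tpow_power TX 2 P, tpow_power TY 2 Z).
have a := sub _ _ _ U _ (tp_tadd TX P); have a' := sub _ _ _ U' _ (tp_tadd TY Z).
have p0 := sub _ _ _ U _ (bX ord0); have p0' := sub _ _ _ U' _ (bY ord0).
have p1 := sub _ _ _ U _ (bX ord_max); have p1' := sub _ _ _ U' _ (bY ord_max).
have uM : N `<=` u @^-1` M by [].
have q0 : N `<=` lrs_comp G (lrs_comp (umap (tproj TX P ord0)) u) @^-1` zt_inv TY U'.
  by move=> y /p0/lG.
have q1 : N `<=` lrs_comp G (lrs_comp (umap (tproj TX P ord_max)) u) @^-1` zt_inv TY U'.
  by move=> y /p1/lG.
have q0' : N `<=` lrs_comp (umap (tproj TY Z ord0)) v @^-1` zt_inv TY U' by rewrite e1.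
have q1' : N `<=` lrs_comp (umap (tproj TY Z ord_max)) v @^-1` zt_inv TY U' by rewrite e2.
have vM : N `<=` v @^-1` M'.
  by move=> y /q0'; rewrite /M' -(bY ord0).
have l : N `<=` lrs_comp (umap (tadd TY Z)) v @^-1` zt_inv TY U' by move=> y /vM/a'.
have l' : N `<=` lrs_comp G (lrs_comp (umap (tadd TX P)) u) @^-1` zt_inv TY U'.
  by move=> y /uM/a/lG.
exists V', U', N, l, l'; split=> // b.
have GM (c : hom (tpow TX 2 P) (TX P)) (s : M `<=` umap c @^-1` zt_inv TX U)
    (r : N `<=` lrs_comp G (lrs_comp (umap c) u) @^-1` zt_inv TY U') x :
    pull r x = pull uM (pull s (pull lG x)).
  have r' : N `<=` lrs_comp (umap c) u @^-1` zt_inv TX U by move=> y /uM/s.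
  by rewrite (pull_comp r r' lG) (pull_comp r' uM s).
rewrite !(pull_comp l vM a') !(GM _ a) (tmap_sharp (tmap_base gG) k) (tmap_d gG h h' k).
have [-> ->] := zt_add h a p0 p1 (pull k b).
have [-> ->] := zt_add h' a' p0' p1' b.
rewrite !rmorphD -!(pull_comp q0' vM p0') -!(pull_comp q1' vM p1').
rewrite !(pull_eq q0' q0 _ e1) !(pull_eq q1' q1 _ e2) !(GM _ p0) !(GM _ p1).
by rewrite (tmap_sharp (tmap_base gG) k) (tmap_d gG h h' k).
Qed.

Variable GG : LRSHom (usch (TX (TX P))) (usch (TY (TY Z))).
Hypothesis GGG : is_tangent_map TX TY G GG.

Lemma lift_sub (S : Scheme) (TS : ZariskiTangentStructure S) (K : SchOver S) (U : opens (usch K)) :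
  zt_inv TS U `<=` umap (tl TS K) @^-1` zt_inv TS (zt_inv TS U).
Proof.
have e : tp TS K ∘ tp TS (TS K) ∘ tl TS K = tp TS K.
  by rewrite -tp_nat -comp_assoc tl_bundle comp_assoc tp_t0 comp_idl.
move=> t Ut; have : oset U (umap (tp TS K ∘ tp TS (TS K) ∘ tl TS K) t) by rewrite e.
by [].
Qed.

Lemma flip_sub (S : Scheme) (TS : ZariskiTangentStructure S) (K : SchOver S) (U : opens (usch K)) :
  zt_inv TS (zt_inv TS U) `<=` umap (tc TS K) @^-1` zt_inv TS (zt_inv TS U).
Proof.
have e : tp TS K ∘ tp TS (TS K) ∘ tc TS K = tp TS K ∘ tp TS (TS K).
  by rewrite -comp_assoc tc_bundle tp_nat.
move=> t Ut; have : oset U (umap (tp TS K ∘ tp TS (TS K) ∘ tc TS K) t) by rewrite e.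
by [].
Qed.

Lemma tmap_tl : lrs_comp GG (umap (tl TX P)) = lrs_comp (umap (tl TY Z)) G.
Proof.
apply: tangent2_hom_eq => t.
have [V [U [V' [U' [h h' Ut k _]]]]] :=
  @exists_piece_map X Y P Z g (Opens openT) (Opens openT) (zt_p TX P t) I I.
have lG := tmap_sub (tmap_base gG) k; have lGG := tmap_sub (tmap_base GGG) lG.
have c := @lift_sub X TX P U; have c' := @lift_sub Y TY Z U'.
pose N := zt_inv TX U.
have l : N `<=` lrs_comp GG (umap (tl TX P)) @^-1` zt_inv TY (zt_inv TY U') by move=> y /c/lGG.
have l' : N `<=` lrs_comp (umap (tl TY Z)) G @^-1` zt_inv TY (zt_inv TY U').
  by move=> y /lG/c'.
exists V', U', N, l, l'; split=> // b.
have [e1 e2 e3 e4] := zt_lift h (@subset_refl _ _) c (pull k b).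
have [f1 f2 f3 f4] := zt_lift h' (@subset_refl _ _) c' b.
rewrite !(pull_comp l c lGG) !(pull_comp l' lG c').
rewrite !(tmap_sharp (tmap_base GGG) lG lGG) !(tmap_d GGG (piece_inv TX h) (piece_inv TY h') lG lGG).
rewrite !(tmap_sharp (tmap_base gG) k) !(tmap_d gG h h' k).
split.
- by rewrite e1 f1 !rs_res_id (tmap_sharp (tmap_base gG) k).
- by rewrite e2 f2 rmorph0.
- by rewrite e3 f3 rmorph0.
- by rewrite e4 f4 !rs_res_id (tmap_d gG h h' k).
Qed.

Lemma tmap_tc : lrs_comp GG (umap (tc TX P)) = lrs_comp (umap (tc TY Z)) GG.
Proof.
apply: tangent2_hom_eq => t.
have [V [U [V' [U' [h h' Ut k _]]]]] :=
  @exists_piece_map X Y P Z g (Opens openT) (Opens openT) (zt_p TX P (zt_p TX (TX P) t)) I I.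
have lG := tmap_sub (tmap_base gG) k; have lGG := tmap_sub (tmap_base GGG) lG.
have c := @flip_sub X TX P U; have c' := @flip_sub Y TY Z U'.
pose N := zt_inv TX (zt_inv TX U).
have l : N `<=` lrs_comp GG (umap (tc TX P)) @^-1` zt_inv TY (zt_inv TY U') by move=> y /c/lGG.
have l' : N `<=` lrs_comp (umap (tc TY Z)) GG @^-1` zt_inv TY (zt_inv TY U').
  by move=> y /lGG/c'.
exists V', U', N, l, l'; split=> // b.
have [e1 e2 e3 e4] := zt_flip h (@subset_refl _ _) c (pull k b).
have [f1 f2 f3 f4] := zt_flip h' (@subset_refl _ _) c' b.
have Es := tmap_sharp (tmap_base GGG) lG lGG.
have Ed := tmap_d GGG (piece_inv TX h) (piece_inv TY h') lG lGG.
rewrite !(pull_comp l c lGG) !(pull_comp l' lGG c') f1 f2 f3 f4 !rs_res_id !Es !Ed.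
rewrite !(tmap_sharp (tmap_base gG) k) !(tmap_d gG h h' k).
by rewrite e1 e2 e3 e4 !rs_res_id.
Qed.

End TangentMapNaturality.

(** * Tangent maps of base change projections *)

Section Difference.
Variables (X : Scheme) (TX : ZariskiTangentStructure X) (P : SchOver X) (Q : Scheme).
Variables g h : LRSHom Q (usch (TX P)).
Hypothesis gh : lrs_comp (zt_p TX P) g = lrs_comp (zt_p TX P) h.

Let m := lrs_comp (zt_p TX P) g.

Record piece := Piece {
  pc_V : opens X; pc_U : opens (usch P); pc_h : affine_piece (Z := P) pc_V pc_U }.

Lemma diff_sub_l (U : opens (usch P)) : preim m U `<=` g @^-1` zt_inv TX U.
Proof. by []. Qed.

Lemma diff_sub_r (U : opens (usch P)) : preim m U `<=` h @^-1` zt_inv TX U.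
Proof. by rewrite /m gh. Qed.

Let D i (r : rs_O (pc_U i)) : rs_O (preim m (pc_U i)) :=
  pull (@diff_sub_l (pc_U i)) (zt_d TX r) - pull (@diff_sub_r (pc_U i)) (zt_d TX r).

Let beta i : {rmorphism rs_O (pc_U i) -> rs_O (preim m (pc_U i))} := lh_sharp m (pc_U i).

Let DD i (a b : rs_O (pc_U i)) : D (a + b) = D a + D b.
Proof. by have [dD _ _] := zt_der TX (pc_h i); rewrite /D dD !rmorphD; ring. Qed.

Let DM i (a b : rs_O (pc_U i)) : D (a * b) = beta i a * D b + beta i b * D a.
Proof.
have [_ dM _] := zt_der TX (pc_h i); rewrite /D dM !rmorphD !rmorphM.
have e (r : rs_O (pc_U i)) : pull (@diff_sub_l (pc_U i)) (lh_sharp (zt_p TX P) (pc_U i) r) = beta i r.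
  by rewrite /pull /= rs_res_id.
have e' (r : rs_O (pc_U i)) : pull (@diff_sub_r (pc_U i)) (lh_sharp (zt_p TX P) (pc_U i) r) = beta i r.
  have l : preim m (pc_U i) `<=` lrs_comp (zt_p TX P) h @^-1` pc_U i by rewrite /m gh.
  have l' : preim m (pc_U i) `<=` m @^-1` pc_U i by [].
  by rewrite (pull_sharp _ l) -(pull_eq l' l r gh) /pull /= rs_res_id.
by rewrite !e !e'; ring.
Qed.

(* In symbols [K^♯ r = r + ε (g^♯ (dr) - h^♯ (dr))]. *)
Lemma dual_diff_ex : exists K : LRSHom (dual_sch Q) (usch P),
  forall V (U : opens (usch P)), affine_piece V U ->
  forall W : opens Q, W `<=` m @^-1` U -> exists l : (W : opens (dual_sch Q)) `<=` K @^-1` U,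
  forall (k : W `<=` m @^-1` U) (lg : W `<=` g @^-1` zt_inv TX U)
    (lh : W `<=` h @^-1` zt_inv TX U) r,
    pull l r = (pull k r, pull lg (zt_d TX r) - pull lh (zt_d TX r)).
Proof.
pose A i := pc_U i.
pose W i : opens (dual_sch Q) := preim m (pc_U i).
pose phi i : {rmorphism rs_O (A i) -> rs_O (W i)} := dual_rmorphism (@DD i) (@DM i).
have [i|t|i j t Wi Wj|K [KA KE]] := @lrs_glue (dual_sch Q) (usch P) piece A W phi.
- exact: piece_total (pc_h i).
- have [V [U [p Ut _ _]]] := @exists_piece X P (Opens openT) (Opens openT) (m t) I I.
  by exists (Piece p).
- have [V [U [p Ut UO _]]] :=
    @exists_piece X P (opensI (pc_U i) (pc_U j)) (Opens openT) (m t) (conj Wi Wj) I.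
  have ui : U `<=` pc_U i by move=> y /UO[].
  have uj : U `<=` pc_U j by move=> y /UO[].
  have wi : W (Piece p) `<=` W i by move=> y /ui.
  have wj : W (Piece p) `<=` W j by move=> y /uj.
  have E k (u : U `<=` pc_U k) (w : preim m U `<=` preim m (pc_U k)) r :
      phi (Piece p) (rs_res u r) = @rs_res (dual_sch Q) _ _ w (phi k r).
    have v : zt_inv TX U `<=` zt_inv TX (pc_U k) by move=> y /u.
    congr pair.
      exact (@lh_natural _ _ m (pc_U k) U u w r).
    rewrite /= /D -!(zt_d_res u v r (pc_h k) p) rmorphB.
    have l1 : preim m U `<=` g @^-1` zt_inv TX (pc_U k) by move=> y /u.
    have l2 : preim m U `<=` h @^-1` zt_inv TX (pc_U k) by move=> y /diff_sub_r/v.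
    by rewrite (pull_res _ v l1) (pull_res _ v l2) (res_pull _ w l1) (res_pull _ w l2).
  by exists (Piece p), ui, uj, wi, wj.
exists K => V U p N NU.
have w : N `<=` preim m U by [].
have l : (N : opens (dual_sch Q)) `<=` K @^-1` U by move=> y /w/(KA (Piece p)).
exists l => k lg lh r.
rewrite -(res_pull (KA (Piece p)) w l) KE; congr pair => /=.
  by rewrite /pull /=; exact: rs_res_irr.
rewrite /D rmorphB.
by rewrite (res_pull _ w lg) (res_pull _ w lh).
Qed.

End Difference.

Lemma is_pullback_eq (C : Category) (A B S P : C) (a : hom A S) (b : hom B S)
    (p1 : hom P A) (p2 : hom P B) (W : C) (u v : hom W P) :
  is_pullback a b p1 p2 -> p1 ∘ u = p1 ∘ v -> p2 ∘ u = p2 ∘ v -> u = v.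
Proof.
move=> [e /(_ W (p1 ∘ v) (p2 ∘ v))]; rewrite !comp_assoc e => /(_ erefl)[w [_ H]] e1 e2.
by rewrite -(H u) // -(H v).
Qed.

(** * Joint monicity of the differential of a projection and the structure map *)

Section JointMono.
Variables (X Y : Scheme) (f : @hom Sch X Y).
Variables (TX : ZariskiTangentStructure X) (TY : ZariskiTangentStructure Y).
Variables (P : SchOver X) (Z : SchOver Y) (q : @hom Sch (usch P) (usch Z)).
Hypothesis pbP : @is_pullback Sch _ _ _ _ (over_map Z) f q (over_map P).
Variable G : LRSHom (usch (TX P)) (usch (TY Z)).
Hypothesis qG : is_tangent_map TX TY q G.

Lemma tmap_jointly_monic (Q : Scheme) (g h : LRSHom Q (usch (TX P))) :
  lrs_comp G g = lrs_comp G h -> lrs_comp (ustr (TX P)) g = lrs_comp (ustr (TX P)) h -> g = h.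
Proof.
move=> eG es.
have str : lrs_comp (ustr P) (zt_p TX P) = ustr (TX P) by exact (proj2_sig (tp TX P)).
have gh : lrs_comp (zt_p TX P) g = lrs_comp (zt_p TX P) h.
  apply: (@is_pullback_eq Sch _ _ _ _ _ _ _ _ _ _ _ pbP); rewrite /=.
    by rewrite !lrs_comp_assoc -(tmap_base qG) -!lrs_comp_assoc eG.
  by rewrite !lrs_comp_assoc str.
have [K HK] := dual_diff_ex gh.
(* Applied to [g] and [g], the construction gives the zero tangent vector along [p ∘ g]. *)
have [K0 HK0] := dual_diff_ex (erefl (lrs_comp (zt_p TX P) g)).
have eK : K = K0.
  apply: (@is_pullback_eq Sch (usch Z) X Y (usch P) _ _ _ _ (dual_sch Q) K K0 pbP).
    apply: lrs_hom_eq => t.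
    have [V [U [V' [U' [p p' Ut k _]]]]] :=
      @exists_piece_map X Y P Z q (Opens openT) (Opens openT) (lrs_comp (zt_p TX P) g t) I I.
    pose N := preim (lrs_comp (zt_p TX P) g) U.
    have [l E] := HK V U p N (@subset_refl _ _).
    have [l0 E0] := HK0 V U p N (@subset_refl _ _).
    have lg := @diff_sub_l _ _ _ _ g U; have lh := @diff_sub_r _ _ _ _ _ _ gh U.
    have lG := tmap_sub (tmap_base qG) k.
    have L : (N : opens (dual_sch Q)) `<=` lrs_comp q K @^-1` U' by move=> y /l/k.
    have L0 : (N : opens (dual_sch Q)) `<=` lrs_comp q K0 @^-1` U' by move=> y /l0/k.
    exists U', N, L, L0; split=> //; first exact: piece_total p'.
    move=> b; rewrite (pull_comp L l k) (pull_comp L0 l0 k).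
    rewrite (E (@subset_refl _ _) lg lh) (E0 (@subset_refl _ _) lg lg).
    (* Over [Z], [d (q^♯ b)] is the pullback of [db] along [G], so the [ε]-part is a difference of
       two pullbacks that [eG] identifies. *)
    rewrite -!(tmap_d qG p p' k lG).
    have Lg : N `<=` lrs_comp G g @^-1` zt_inv TY U' by move=> y /lg/lG.
    have Lh : N `<=` lrs_comp G h @^-1` zt_inv TY U' by move=> y /lh/lG.
    by rewrite -(pull_comp Lg lg lG) -(pull_comp Lh lh lG) (pull_eq Lg Lh _ eG) !subrr.
  apply: lrs_hom_eq => t.
  have [V [U [p Ut _ _]]] :=
    @exists_piece X P (Opens openT) (Opens openT) (lrs_comp (zt_p TX P) g t) I I.
  pose N := preim (lrs_comp (zt_p TX P) g) U.
  have [l E] := HK V U p N (@subset_refl _ _).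
  have [l0 E0] := HK0 V U p N (@subset_refl _ _).
  have lg := @diff_sub_l _ _ _ _ g U; have lh := @diff_sub_r _ _ _ _ _ _ gh U.
  have L : (N : opens (dual_sch Q)) `<=` lrs_comp (ustr P) K @^-1` V.
    by move=> y /l/(piece_sub p).
  have L0 : (N : opens (dual_sch Q)) `<=` lrs_comp (ustr P) K0 @^-1` V.
    by move=> y /l0/(piece_sub p).
  exists V, N, L, L0; split=> //; first exact: piece_base p.
  move=> b; rewrite (pull_comp L l (piece_sub p)) (pull_comp L0 l0 (piece_sub p)).
  rewrite (E (@subset_refl _ _) lg lh) (E0 (@subset_refl _ _) lg lg).
  (* Over [X] the section comes from the base, so [d] kills it and both [ε]-parts vanish. *)
  by have [_ _ dS] := zt_der TX p; rewrite dS !rmorph0.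
subst K0; apply: tangent_hom_eq => t.
have [V [U [p Ut _ _]]] :=
  @exists_piece X P (Opens openT) (Opens openT) (lrs_comp (zt_p TX P) g t) I I.
pose N := preim (lrs_comp (zt_p TX P) g) U.
have [l E] := HK V U p N (@subset_refl _ _).
have [l0 E0] := HK0 V U p N (@subset_refl _ _).
have lg := @diff_sub_l _ _ _ _ g U; have lh := @diff_sub_r _ _ _ _ _ _ gh U.
exists V, U, N, lg, lh; split=> // b; split.
  have Lg : N `<=` lrs_comp (zt_p TX P) g @^-1` U by [].
  have Lh : N `<=` lrs_comp (zt_p TX P) h @^-1` U by rewrite -gh.
  by rewrite (pull_sharp lg Lg) (pull_sharp lh Lh); exact: pull_eq.
have := E (@subset_refl _ _) lg lh b.
rewrite (pull_irr l l0) (E0 (@subset_refl _ _) lg lg) => e.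
have := congr1 (fun u : dual (rs_O N) => u.2) e.
by rewrite /= subrr => /esym/subr0_eq.
Qed.

End JointMono.

(** * Base change is a right adjoint *)

Section BaseChangeAdjunction.
Variables (C : Category) (S S' : C) (f : hom S' S).
Variable pb : forall Z : slice S, pullback_along f Z.

(** The left adjoint of base change. Bijectivity and naturality of [transpose] are all that is used
    to carry universal properties across. *)
Definition slice_push (Q : slice S') : slice S := Over (f ∘ over_map Q).

Lemma transpose_subproof (Q : slice S') (Z : slice S) (x : hom Q (base_change pb Z)) :
  over_map Z ∘ (pb_fst (pb Z) ∘ sval x) = over_map (slice_push Q).
Proof.
have [e _] := pb_pullback (pb Z).
by rewrite comp_assoc e -comp_assoc; congr (_ ∘ _); exact: (proj2_sig x).
Qed.

Definition transpose (Q : slice S') (Z : slice S) (x : hom Q (base_change pb Z)) :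
  hom (slice_push Q) Z := exist _ _ (transpose_subproof x).

Lemma transpose_inj (Q : slice S') (Z : slice S) : injective (@transpose Q Z).
Proof.
move=> x y e; apply: over_hom_eq; apply: (is_pullback_eq (pb_pullback (pb Z))).
  exact (congr1 (fun h : hom (slice_push Q) Z => sval h) e).
by rewrite (proj2_sig x : _ = _) (proj2_sig y : _ = _).
Qed.

Lemma transpose_surj (Q : slice S') (Z : slice S) (y : hom (slice_push Q) Z) :
  exists x : hom Q (base_change pb Z), transpose x = y.
Proof.
have [_ /(_ _ (sval y) (over_map Q))] := pb_pullback (pb Z).
rewrite (proj2_sig y : _ = _) => /(_ erefl)[u [[e1 e2] _]].
by exists (exist _ u e2); apply: over_hom_eq.
Qed.

Lemma transpose_comp (Q : slice S') (Z Z' : slice S) (g : hom Z Z')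
    (x : hom Q (base_change pb Z)) :
  transpose (fm (base_change pb) g ∘ x) = g ∘ transpose x.
Proof. by apply: over_hom_eq; rewrite /= !comp_assoc base_change_mapE. Qed.

Lemma base_change_pullback_power n (A E P : slice S) (p : hom E A) (b : hom P A)
    (pi : 'I_n -> hom P E) : is_pullback_power p b pi ->
  is_pullback_power (fm (base_change pb) p) (fm (base_change pb) b)
    (fun i => fm (base_change pb) (pi i)).
Proof.
move=> [e univ]; split=> [i|W w x ex]; first by rewrite -fm_comp e.
have [i|u [[eb epi] uu]] := univ _ (transpose w) (fun i => transpose (x i)).
  by rewrite -transpose_comp ex.
have [v ev] := transpose_surj u; exists v; split.
  split=> [|i]; apply: transpose_inj; rewrite transpose_comp ev //.
move=> v' [eb' epi']; apply: transpose_inj; rewrite ev; apply: uu.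
by split=> [|i]; rewrite -transpose_comp ?eb' ?epi'.
Qed.

Lemma base_change_equalizer (E A B : slice S) (e : hom E A) (g h : hom A B) :
  is_equalizer e g h ->
  is_equalizer (fm (base_change pb) e) (fm (base_change pb) g) (fm (base_change pb) h).
Proof.
move=> [eq univ]; split=> [|W x ex]; first by rewrite -!fm_comp eq.
have [|u [eu uu]] := univ _ (transpose x); first by rewrite -!transpose_comp ex.
have [v ev] := transpose_surj u; exists v; split.
  by apply: transpose_inj; rewrite transpose_comp ev.
by move=> v' ev'; apply: transpose_inj; rewrite ev; apply: uu; rewrite -transpose_comp ev'.
Qed.

End BaseChangeAdjunction.

(** [T] preserves the pullback power [T_2], so the pairing inside [tTsum] is unique. This identifies
    an arbitrary candidate for [T(+) ∘ ⟨ℓ π1, 0 π2⟩] with the equalizer supplied by the tangent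
    structure. *)
Lemma tTsum_uniq (C : Category) (T : TangentStructure C) (A W : C)
    (x y z z' : hom W (T (T A))) : tTsum T x y z -> tTsum T x y z' -> z = z'.
Proof.
move=> [u [u0 u1 <-]] [u' [u0' u1' <-]]; congr (_ ∘ _).
(* The first power of [T] is convertible to [T]. *)
have [e univ] := tpow_preserved T 1 2 A.
have [|v [_ vv]] := univ _ (fm T (tbase T 2 A) ∘ u) (fun i => fm T (tproj T A i) ∘ u).
  by move=> i; rewrite comp_assoc e.
have <- : v = u by apply: vv.
apply: vv; split=> [|i].
  by rewrite /= -(e ord0) /= -!comp_assoc u0 u0'.
have [->|->] : i = ord0 \/ i = ord_max; last 2 first.
- by rewrite /= u0 u0'.
- by rewrite /= u1 u1'.
by case: i => [[|[|]]] // ilt; [left|right]; exact: val_inj.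
Qed.

(** * The comparison map and the differential of the projection *)

Section BaseChangeTangent.
Variables (X Y : Scheme) (f : @hom Sch X Y) (pb : forall Z : SchOver Y, pullback_along f Z).
Variables (TX : ZariskiTangentStructure X) (TY : ZariskiTangentStructure Y).
Variable fT : forall Z : SchOver Y, hom (base_change pb (TY Z)) (TX (base_change pb Z)).
Hypothesis fT_canonical : is_canonical_comparison pb TX TY fT.

Let H := base_change pb.
Let q (Z : SchOver Y) : LRSHom (usch (H Z)) (usch Z) := pb_fst (pb Z).

Lemma ustr_tangent (S : Scheme) (TS : ZariskiTangentStructure S) (K : SchOver S) :
  lrs_comp (ustr K) (zt_p TS K) = ustr (TS K).
Proof. exact (proj2_sig (tp TS K)). Qed.

Lemma tmap_over (P : SchOver X) (Z : SchOver Y) g G :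
  lrs_comp (ustr Z) g = lrs_comp f (ustr P) -> is_tangent_map TX TY g G ->
  lrs_comp (ustr (TY Z)) G = lrs_comp f (ustr (TX P)).
Proof.
move=> e gG; rewrite -!ustr_tangent -!lrs_comp_assoc (tmap_base gG).
by rewrite !lrs_comp_assoc e.
Qed.

Lemma q_over Z : lrs_comp (ustr Z) (q Z) = lrs_comp f (ustr (H Z)).
Proof. by have [] := pb_pullback (pb Z). Qed.

Lemma q_nat (Z Z' : SchOver Y) (g : hom Z Z') :
  lrs_comp (q Z') (umap (fm H g)) = lrs_comp (umap g) (q Z).
Proof. exact (base_change_mapE pb g). Qed.

Variables (Z : SchOver Y) (Tq : LRSHom (usch (TX (H Z))) (usch (TY Z))).
Hypothesis qTq : is_tangent_map TX TY (q Z) Tq.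

Lemma tmap_fT : lrs_comp Tq (umap (fT Z)) = q (TY Z).
Proof.
apply: tangent_hom_eq => t.
pose z := zt_p TY Z (q (TY Z) t).
have [V [U [p Uz _ _]]] := @exists_piece Y Z (Opens openT) (Opens openT) z I I.
have Vt : oset V (lrs_comp f (ustr (H (TY Z))) t).
  rewrite -q_over -ustr_tangent; exact: (piece_sub p Uz).
have [W [aW Wt WV]] := @affine_basis_scheme X (preim f V) (ustr (H (TY Z)) t) Vt.
have [c1 c2] := @fT_canonical Z V U W p aW WV.
have [z1 z2] := c1 t Uz Wt.
(* Using [d] on [H Z] takes an affine piece, which [U ×_V W] is not known to be. A smaller one is
   chosen around the image of [t], which the first clause of canonicity places over [U] and [W]. *)
have [V1 [U1 [p1 U1t U1O _]]] := @exists_piece X (H Z)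
  (opensI (preim (q Z) U) (preim (ustr (H Z)) W)) (Opens openT) _ (conj z1 z2) I.
have h1 : U1 `<=` q Z @^-1` U by move=> y /U1O[].
have h2 : U1 `<=` ustr (H Z) @^-1` W by move=> y /U1O[].
pose N := opensI (preim (umap (fT Z)) (zt_inv TX U1))
  (opensI (preim (q (TY Z)) (zt_inv TY U)) (preim (ustr (H (TY Z))) W)).
have l : N `<=` umap (fT Z) @^-1` zt_inv TX U1 by move=> y [].
have k1 : N `<=` q (TY Z) @^-1` zt_inv TY U by move=> y [_ []].
have k2 : N `<=` ustr (H (TY Z)) @^-1` W by move=> y [_ []].
have lG := tmap_sub (tmap_base qTq) h1.
have l' : N `<=` lrs_comp Tq (umap (fT Z)) @^-1` zt_inv TY U by move=> y /l/lG.
exists V, U, N, l', k1; split=> // b.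
(* The choice [a = 1] turns [b ⊗ a] and [db ⊗ a] into [b] and [db]. *)
have [] := c2 U1 h1 h2 N l k1 k2 b 1 (piece_total p1).
rewrite !rmorph1 !mulr1 => e1 e2.
rewrite !(pull_comp l' l lG) (tmap_sharp (tmap_base qTq) h1) (tmap_d qTq p1 p h1).
by split.
Qed.

Lemma hom_tangent_eq (Q : SchOver X) (g h : hom Q (TX (H Z))) :
  lrs_comp Tq (umap g) = lrs_comp Tq (umap h) -> g = h.
Proof.
move=> e; apply: over_hom_eq; apply: (tmap_jointly_monic _ qTq) => //.
  exact: pb_pullback.
exact (etrans (proj2_sig g) (esym (proj2_sig h))).
Qed.

Lemma hom_base_change_eq (K : SchOver Y) (Q : SchOver X) (g h : hom Q (H K)) :
  lrs_comp (q K) (umap g) = lrs_comp (q K) (umap h) -> g = h.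
Proof. by move=> e; apply: (@transpose_inj Sch _ _ f pb); apply: over_hom_eq. Qed.

Lemma fT_inverse : exists beta : hom (TX (H Z)) (H (TY Z)),
  beta ∘ fT Z = idm _ /\ fT Z ∘ beta = idm _.
Proof.
have [beta eb] := @transpose_surj Sch Y X f pb (TX (H Z)) (TY Z)
  (exist _ Tq (tmap_over (q_over Z) qTq)).
have {}eb : lrs_comp (q (TY Z)) (umap beta) = Tq by exact (congr1 (@proj1_sig _ _) eb).
exists beta; split.
  apply: hom_base_change_eq.
  rewrite [umap _]/= [X in lrs_comp _ X]/(lrs_comp (umap beta) (umap (fT Z))).
  by rewrite lrs_comp_assoc eb tmap_fT lrs_comp_idr.
apply: hom_tangent_eq.
have -> : umap (fT Z ∘ beta) = lrs_comp (umap (fT Z)) (umap beta) by [].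
by rewrite lrs_comp_assoc tmap_fT eb lrs_comp_idr.
Qed.

End BaseChangeTangent.

Theorem proposition6p15 (X Y : Scheme) (f : @hom Sch X Y)
  (pb : forall Z : SchOver Y, pullback_along f Z)
  (TX : ZariskiTangentStructure X) (TY : ZariskiTangentStructure Y)
  (fT : forall Z : SchOver Y, hom (base_change pb (TY Z)) (TX (base_change pb Z)))
  (fT_canonical : is_canonical_comparison pb TX TY fT) :
  @is_strong_tangent_morphism (SchOver Y) (SchOver X) TY TX (base_change pb) fT.
Proof.
pose H := base_change pb.
pose q (Z : SchOver Y) : LRSHom (usch (H Z)) (usch Z) := pb_fst (pb Z).
have exT Z : exists G, is_tangent_map TX TY (q Z) G by exact (tmap_ex TX TY (q_over pb Z)).
pose Tq Z := sval (cid (exT Z)).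
have TqP Z : is_tangent_map TX TY (q Z) (Tq Z) by exact: (svalP (cid (exT Z))).
have Tq_fT Z : lrs_comp (Tq Z) (umap (fT Z)) = q (TY Z) by exact (tmap_fT fT_canonical (TqP Z)).
have eqT Z (Q : SchOver X) (g h : hom Q (TX (H Z))) :
    lrs_comp (Tq Z) (umap g) = lrs_comp (Tq Z) (umap h) -> g = h.
  exact (@hom_tangent_eq _ _ _ _ _ _ _ _ (TqP Z) Q g h).
have qN (Z Z' : SchOver Y) (g : hom Z Z') :
    lrs_comp (q Z') (umap (fm H g)) = lrs_comp (umap g) (q Z) by exact (q_nat pb g).
have UC (S : Scheme) (A B D : SchOver S) (h : hom B D) (g : hom A B) :
    umap (h ∘ g) = lrs_comp (umap h) (umap g) by [].
have inv Z := fT_inverse fT_canonical (TqP Z).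
have exTT Z : exists GG, is_tangent_map TX TY (Tq Z) GG.
  exact (tmap_ex TX TY (tmap_over (q_over pb Z) (TqP Z))).
pose TTq Z := sval (cid (exTT Z)).
have TTqP Z : is_tangent_map TX TY (Tq Z) (TTq Z) by exact: (svalP (cid (exTT Z))).
(* Both sides are differentials of [q (TY Z)], the left one because [Tq Z ∘ fT Z = q (TY Z)]. *)
have TTq_fT Z : lrs_comp (TTq Z) (umap (fm TX (fT Z))) = Tq (TY Z).
  apply: (tmap_uniq (g := q (TY Z))) => //; rewrite -Tq_fT.
  exact: tmap_comp (tmap_fm TX (fT Z)) (TTqP Z).
(* Joint monicity is proved for differentials of pullback projections, and [Tq Z] is a projection
   only up to the comparison. Factoring [g] and [h] through the invertible [T (fT Z)] reduces the
   claim to [Tq (TY Z)]. *)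
have eqTT Z (Q : SchOver X) (g h : hom Q (TX (TX (H Z)))) :
    lrs_comp (TTq Z) (umap g) = lrs_comp (TTq Z) (umap h) -> g = h.
  have [beta [_ e]] := inv Z => E.
  have gE (k : hom Q (TX (TX (H Z)))) : k = fm TX (fT Z) ∘ (fm TX beta ∘ k).
    by rewrite comp_assoc -fm_comp e fm_id comp_idl.
  rewrite (gE g) (gE h); congr (_ ∘ _); apply: eqT.
  by rewrite -TTq_fT -!lrs_comp_assoc -!UC -!gE.
have nat_p Z : tp TX (H Z) ∘ fT Z = fm H (tp TY Z).
  apply: (@hom_base_change_eq X Y f pb Z); rewrite -/(q Z) qN UC lrs_comp_assoc.
  by rewrite -(tmap_base (TqP Z)) -lrs_comp_assoc Tq_fT.
split; [split| | |].
- move=> A B g; apply: eqT; rewrite !UC !lrs_comp_assoc Tq_fT qN.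
  (* Both sides are differentials of one map, since [q B ∘ H g = g ∘ q A]. *)
  have -> : lrs_comp (Tq B) (umap (fm TX (fm H g))) = lrs_comp (umap (fm TY g)) (Tq A).
    apply: (tmap_uniq (g := lrs_comp (q B) (umap (fm H g)))).
      exact: tmap_comp (tmap_fm TX _) (TqP B).
    by rewrite qN; exact: tmap_comp (TqP A) (tmap_fm TY g).
  by rewrite -lrs_comp_assoc Tq_fT.
- exact: nat_p.
- move=> A; apply: eqT; rewrite !UC lrs_comp_assoc Tq_fT qN.
  by rewrite (tmap_0 (TqP A)).
- move=> A; have [bE univ] := tpow_power TX 2 (H A).
  have [bY _] := tpow_power TY 2 A.
  (* Here [u] is [α_2]; it exists because [nat_p] gives its two components the same base. *)
  have [i|u [[_ ui] _]] := univ _ (fm H (tbase TY 2 A)) (fun i => fT A ∘ fm H (tproj TY A i)).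
    by rewrite comp_assoc nat_p -fm_comp bY.
  exists u; split; rewrite ?ui //; apply: eqT; rewrite !UC [RHS]lrs_comp_assoc Tq_fT qN.
  symmetry; apply: (tmap_add (TqP A)); rewrite -UC ui UC lrs_comp_assoc Tq_fT;
    by rewrite qN.
- move=> A; apply: eqTT; rewrite !UC !lrs_comp_assoc TTq_fT (tmap_tl (TqP A) (TTqP A)).
  by rewrite -[LHS]lrs_comp_assoc !Tq_fT qN.
- move=> A; apply: eqTT; rewrite !UC !lrs_comp_assoc TTq_fT (tmap_tc (TqP A) (TTqP A)).
  rewrite -[X in lrs_comp X _]lrs_comp_assoc TTq_fT -[LHS]lrs_comp_assoc !Tq_fT.
  by rewrite qN.
- by move=> A; have [beta] := inv A; exists beta.
- by move=> n A; apply: base_change_pullback_power; exact: tpow_power.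
- move=> A v hv; have [v' [hv' eqv]] := t_universal TY A.
  by rewrite (tTsum_uniq hv hv'); exact: base_change_equalizer.
Qed.
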